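(* An ordered field $K$ is symmetrically complete if and only if it is spherically complete w.r.t. its natural valuation $v$, has residue field $\mathbb{R}$ and a strongly symmetrically complete value group $vK$. Further, the following are equivalent: a) $K$ is strongly symmetrically complete, b) $K$ is extremely symmetrically complete, c) $K$ is spherically complete w.r.t. its natural valuation $v$, has residue field $\mathbb{R}$ and an extremely symmetrically complete value group $vK$.
   Context: Ordered means linearly ordered. Natural valuation of an ordered field $K$: $a,b\in K$ are archimedean equivalent if there is $n\in\mathbb{N}$ with $n|a|\ge|b|$ and $n|b|\ge|a|$; $va$ denotes the archimedean equivalence class of $a$, and classes are ordered by $va>vb$ iff $n|a|<|b|$ for all $n\in\mathbb{N}$, with $\infty:=v0$. With $va+vb:=v(ab)$, the set $vK=\{va\mid 0\neq a\in K\}$ is an ordered abelian group (the value group), and $v$ is a field valuation. Its residue field $Kv=\{a\mid va\ge 0\}/\{a\mid va>0\}$ is archimedean ordered and is identified with a subfield of $\mathbb{R}$ via the (order preserving) embedding into $\mathbb{R}$; ''residue field $\mathbb{R}$'' means that this subfield is all of $\mathbb{R}$. Ultrametric balls are the sets $B_u(a,b)=\{g\in K\mid v(a-g)\ge v(a-b)\}$, $a,b\in K$. $K$ is spherically complete w.r.t. its natural valuation if every nonempty chain (w.r.t. inclusion) of ultrametric balls has nonempty intersection. A cut in a linearly ordered set $I$ is a pair $(D,E)$ of nonempty subsets with $I=D\cup E$ and $d<e$ for all $d\in D$, $e\in E$. Its cofinality is $(\kappa,\lambda)$ with $\kappa=\mathrm{cf}(D)$ the cofinality of $D$ and $\lambda=\mathrm{ci}(E)$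 the coinitiality of $E$ (cofinality under the reversed ordering); these equal $1$ when $D$ has a maximum, resp. $E$ has a minimum. The cut is asymmetric if $\kappa\ne\lambda$, and strongly asymmetric if moreover at least one of $\kappa,\lambda$ is uncountable. $I$ is symmetrically complete (strongly symmetrically complete) if every cut in $I$ is asymmetric (strongly asymmetric); it is extremely symmetrically complete if it is strongly symmetrically complete and both its coinitiality and cofinality are uncountable. An ordered abelian group or field has one of these properties if its underlying linearly ordered set does. *)

(* Defs.v *)
From HB Require Import structures.
From mathcomp Require Import all_boot all_order all_algebra generic_quotient.
From mathcomp Require Import ring_quotient.
From mathcomp Require Import boolp classical_sets functions cardinality reals.

Set Implicit Arguments.
Unset Strict Implicit.
Unset Printing Implicit Defensive.
Import Order.TTheory GRing.Theory Num.Theory.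

Local Open Scope classical_set_scope.
Local Open Scope card_scope.
Local Open Scope quotient_scope.
Local Open Scope ring_scope.

(* Zorn's lemma is applied to the sets S of choice functions for F on which
   every evaluation f |-> f A is injective. *)
Lemma exists_least_card (T : Type) (F : set (set T)) : F !=set0 ->
  exists2 A, F A & forall B, F B -> A #<= B.
Proof.
move=> [A0 FA0].
pose P (S : set (set T -> T)) :=
  (forall f A, S f -> F A -> A (f A)) /\
  (forall A f g, F A -> S f -> S g -> f A = g A -> f = g).
have [G GP totG|S [[SF Sinj] maxS]] := @Zorn_bigcup _ P.
  split=> [f A [X GX Xf] FA|A f g FA [X GX Xf] [Y GY Yg] fg].
    exact: (GP _ GX).1 f A Xf FA.
  have [XY|YX] := totG _ _ GX GY.
    by have [_ h] := GP _ GY; apply: (h A) => //; exact: XY.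
  by have [_ h] := GP _ GX; apply: (h A) => //; exact: YX.
have [[A [FA AS]]|nA] := pselect (exists A, F A /\
    A `<=` (fun f : set T -> T => f A) @` S).
  exists A => // B FB.
  apply: card_le_trans (subset_card_le AS) _.
  apply: card_le_trans (card_image_le _ _) _.
  have /card_esym : ((fun f : set T -> T => f B) @` S) #= S.
    by apply: inj_card_eq => f g /set_mem Sf /set_mem Sg; exact: Sinj.
  rewrite card_eq_le => /andP[SB _]; apply: card_le_trans SB _.
  by apply: subset_card_le => _ [f Sf <-]; exact: SF f B Sf FB.
exfalso.
have hP A : exists x, F A -> A x /\ ~ ((fun f : set T -> T => f A) @` S) x.
  have [FA|nFA] := pselect (F A); last first.
    have [[x _]|nT] := pselect (exists x : T, True); first by exists x.
    by exfalso; apply: nA; exists A0; split=> // x; case: nT; exists x.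
  have : ~ (A `<=` (fun f : set T -> T => f A) @` S).
    by move=> AS; apply: nA; exists A.
  by rewrite -existsNP => -[x]; rewrite not_implyP => xP; exists x.
have [h hh] := choice hP.
apply: (maxS (S `|` [set h])).
  rewrite properEneq; split; last by move=> f; left.
  apply/eqP => SE; have Sh : S h by rewrite SE; right.
  by have [_ []] := hh _ FA0; exists h.
split=> [f A [Sf|->] FA|A f g FA]; first exact: SF f A Sf FA.
  by have [] := hh _ FA.
move=> [Sf|->] [Sg|->] // fg.
- exact: Sinj fg.
- by have [_ []] := hh _ FA; exists f.
- by have [_ []] := hh _ FA; exists g.
Qed.

Section Cofinality.
Variables (T : Type) (r : rel T).

Definition cofinal_in (D A : set T) : Prop :=
  A `<=` D /\ forall d, D d -> exists2 a, A a & r d a.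

(* A cofinal subset of D of least cardinality. It stands for the cardinal
   cf(D), so it is meaningful only up to equinumerosity (#=). *)
Definition cf (D : set T) : set T :=
  xget set0 [set A | cofinal_in D A /\ forall B, cofinal_in D B -> A #<= B].

Lemma cfP (D : set T) : reflexive r ->
  cofinal_in D (cf D) /\ forall B, cofinal_in D B -> cf D #<= B.
Proof.
move=> rr; rewrite /cf; case: xgetP => [A _ //|noA]; exfalso.
have [|A DA minA] := @exists_least_card _ [set A | cofinal_in D A].
  by exists D; split=> // d Dd; exists d.
by apply: (noA A); split.
Qed.

End Cofinality.

Section Cuts.
Variables (d : Order.disp_t) (T : orderType d).

Definition cut (D E : set T) : Prop :=
  [/\ D !=set0, E !=set0, D `|` E = setT
    & forall x y, D x -> E y -> (x < y)%O].

Definition cofinality (D : set T) : set T := cf <=%O D.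

Definition coinitiality (E : set T) : set T := cf >=%O E.

Definition asymmetric_cut (D E : set T) : Prop :=
  ~~ (cofinality D #= coinitiality E).

Definition strongly_asymmetric_cut (D E : set T) : Prop :=
  asymmetric_cut D E /\
  (~ countable (cofinality D) \/ ~ countable (coinitiality E)).

End Cuts.

Definition symmetrically_complete d (T : orderType d) : Prop :=
  forall D E : set T, cut D E -> asymmetric_cut D E.

Definition strongly_symmetrically_complete d (T : orderType d) : Prop :=
  forall D E : set T, cut D E -> strongly_asymmetric_cut D E.

Definition extremely_symmetrically_complete d (T : orderType d) : Prop :=
  [/\ strongly_symmetrically_complete T,
      ~ countable (coinitiality [set: T])
    & ~ countable (cofinality [set: T])].

Section NaturalValuation.
Variable K : realFieldType.
Implicit Types a b c : K.

Definition arch_equiv a b : bool :=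
  `[< exists n : nat, `|b| <= `|a| *+ n /\ `|a| <= `|b| *+ n >].

Let dom a b : Prop := exists n : nat, `|b| <= `|a| *+ n.

Let domxx a : dom a a. Proof. by exists 1%N. Qed.

Let dom_trans b a c : dom a b -> dom b c -> dom a c.
Proof.
move=> [n ab] [m bc]; exists (n * m)%N; apply: le_trans bc _.
by rewrite mulrnA lerMn2r ab orbT.
Qed.

Let arch_equivP a b : reflect (dom a b /\ dom b a) (arch_equiv a b).
Proof.
apply: (iffP (asboolP _)) => [[n [ab ba]]|[[n ab] [m ba]]].
  by split; exists n.
exists (n + m)%N; split.
  by apply: le_trans ab _; rewrite ler_wpMn2l ?leq_addr.
by apply: le_trans ba _; rewrite ler_wpMn2l ?leq_addl.
Qed.

Lemma arch_equiv_is_equiv : equiv_class_of arch_equiv.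
Proof.
split=> [a|a b|b a c].
- by apply/arch_equivP.
- by apply/arch_equivP/arch_equivP => -[].
- move=> /arch_equivP[ab ba] /arch_equivP[bc cb].
  by apply/arch_equivP; split; apply: (@dom_trans b).
Qed.

Canonical arch_equiv_equiv := EquivRelPack arch_equiv_is_equiv.
Canonical arch_equiv_encModRel := defaultEncModRel arch_equiv.

(* The archimedean classes of all elements of K, that of 0 included: this is
   vK together with the element oo. *)
Definition arch_class := {eq_quot arch_equiv}.

HB.instance Definition _ := EqQuotient.on arch_class.
HB.instance Definition _ := Choice.on arch_class.

Definition nval a : arch_class := \pi_arch_class a.

Let nval_repr (x : arch_class) : nval (repr x) = x.
Proof. exact: reprK. Qed.

Let nval_eqP a b : nval a = nval b <-> dom a b /\ dom b a.
Proof.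
split=> [/eqmodP/arch_equivP //|h]; exact/eqmodP/arch_equivP.
Qed.

(* Larger elements of K have smaller values. *)
Definition arch_lt (x y : arch_class) : bool :=
  `[< forall n : nat, `|repr y| *+ n < `|repr x| >].

Definition arch_le (x y : arch_class) : bool := (x == y) || arch_lt x y.

Let ndomP a b : ~ dom a b <-> forall n : nat, `|a| *+ n < `|b|.
Proof.
rewrite -forallNP; split=> h n; first by rewrite real_ltNge ?num_real//; exact/negP.
by apply/negP; rewrite -real_ltNge ?num_real.
Qed.

Let dom_total a b : dom a b \/ dom b a.
Proof.
by have [|/ltW] := leP `|b| `|a|; [left|right]; exists 1%N.
Qed.

Let arch_ltP x y : arch_lt x y <-> ~ dom (repr y) (repr x).
Proof. by rewrite ndomP; split=> /asboolP. Qed.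

Let arch_lt_irr : irreflexive arch_lt.
Proof. by move=> x; apply/negP => /arch_ltP; apply. Qed.

Let arch_lt_trans : transitive arch_lt.
Proof.
move=> y x z /arch_ltP yx /arch_ltP zy; apply/arch_ltP => zx.
have [yz|//] := dom_total (repr y) (repr z).
by apply: yx; exact: dom_trans yz zx.
Qed.

Let arch_lt_total x y : x != y -> arch_lt x y || arch_lt y x.
Proof.
move=> xy; apply/orP; apply: contrapT => /not_orP[].
move=> /arch_ltP/contrapT yx /arch_ltP/contrapT xy'.
by move/eqP: xy; apply; rewrite -[x]nval_repr -[y]nval_repr; apply/nval_eqP.
Qed.

HB.instance Definition _ := Order.LtOrder.Build ring_display arch_class
  (fun _ _ => erefl : arch_le _ _ = _) (fun _ _ => erefl) (fun _ _ => erefl)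
  arch_lt_irr arch_lt_trans arch_lt_total.

Lemma nval_eq a b : nval a = nval b <->
  exists n : nat, `|b| <= `|a| *+ n /\ `|a| <= `|b| *+ n.
Proof. by split=> [/eqmodP/asboolP|h] //; exact/eqmodP/asboolP. Qed.

Lemma nval_le a b : nval a <= nval b <-> exists n : nat, `|b| <= `|a| *+ n.
Proof.
have [ar ra] := (nval_eqP _ _).1 (nval_repr (nval a)).
have [br rb] := (nval_eqP _ _).1 (nval_repr (nval b)).
rewrite leNgt; split=> [/negP nba|ab].
  have rab : dom (repr (nval a)) (repr (nval b)).
    by apply: contrapT => ?; apply: nba; apply/arch_ltP.
  exact: dom_trans ra (dom_trans rab br).
by apply/negP => /arch_ltP; apply; exact: dom_trans ar (dom_trans ab rb).
Qed.

Lemma nval_lt a b : nval a < nval b <-> forall n : nat, `|b| *+ n < `|a|.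
Proof.
rewrite -ndomP ltNge; split=> [/negP h /nval_le //|h].
by apply/negP => /nval_le.
Qed.

Lemma nval_eq0 a : (nval a == nval 0) = (a == 0).
Proof.
apply/eqP/eqP => [/nval_eq[n [_]]|-> //].
by rewrite normr0 mul0rn normr_le0 => /eqP.
Qed.

Lemma nval_le_infty a : nval a <= nval 0.
Proof. by apply/nval_le; exists 0%N; rewrite normr0. Qed.

Definition arch_add (x y : arch_class) : arch_class := nval (repr x * repr y).

Lemma nvalM a b : nval (a * b) = arch_add (nval a) (nval b).
Proof.
have [ar ra] := (nval_eqP _ _).1 (nval_repr (nval a)).
have [br rb] := (nval_eqP _ _).1 (nval_repr (nval b)).
have domM a' b' c d : dom a' c -> dom b' d -> dom (a' * b') (c * d).
  move=> [n h] [m k]; exists (n * m)%N; rewrite !normrM.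
  apply: le_trans (ler_pM _ _ h k) _ => //.
  by rewrite mulrnAl mulrnAr -mulrnA mulnC.
by apply/nval_eqP; split; exact: domM.
Qed.

Record value_group := ValueGroup {
  vg_val :> arch_class;
  vg_valP : vg_val != nval 0 }.

HB.instance Definition _ := [isSub for vg_val].
HB.instance Definition _ := [Choice of value_group by <:].
HB.instance Definition _ :=
  [SubChoice_isSubOrder of value_group by <: with ring_display].

Let vg_repr (x : value_group) : repr (val x) != 0.
Proof. by rewrite -nval_eq0 nval_repr; exact: vg_valP. Qed.

Definition vg_of a (a0 : a != 0) : value_group :=
  @ValueGroup (nval a) (etrans (congr1 negb (nval_eq0 a)) a0).

Definition vg_zero : value_group := vg_of (oner_neq0 K).

Definition vg_add (x y : value_group) : value_group :=
  vg_of (mulf_neq0 (vg_repr x) (vg_repr y)).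

Definition vg_opp (x : value_group) : value_group :=
  vg_of (invr_neq0 (vg_repr x)).

Let vg_reprP (x : value_group) : exists2 a, a != 0 & val x = nval a.
Proof. by exists (repr (val x)); rewrite ?vg_repr ?nval_repr. Qed.

Let vg_addE x y : val (vg_add x y) = arch_add (val x) (val y).
Proof. by []. Qed.

Let vg_addA : associative vg_add.
Proof.
move=> x y z; apply: val_inj; rewrite !vg_addE.
have [a _ ->] := vg_reprP x; have [b _ ->] := vg_reprP y.
by have [c _ ->] := vg_reprP z; rewrite -!nvalM mulrA.
Qed.

Let vg_addC : commutative vg_add.
Proof.
move=> x y; apply: val_inj; rewrite !vg_addE.
by have [a _ ->] := vg_reprP x; have [b _ ->] := vg_reprP y; rewrite -!nvalM mulrC.
Qed.

Let vg_add0 : left_id vg_zero vg_add.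
Proof.
move=> x; apply: val_inj; rewrite vg_addE.
by have [a _ ->] := vg_reprP x; rewrite -nvalM mul1r.
Qed.

Let vg_addN : left_inverse vg_zero vg_opp vg_add.
Proof.
move=> x; apply: val_inj; rewrite vg_addE.
by rewrite -[X in arch_add _ X]nval_repr -nvalM mulVf ?vg_repr.
Qed.

HB.instance Definition _ :=
  GRing.isZmodule.Build value_group vg_addA vg_addC vg_add0 vg_addN.

Lemma vg_ofM a b (a0 : a != 0) (b0 : b != 0) :
  vg_of (mulf_neq0 a0 b0) = vg_of a0 + vg_of b0.
Proof. by apply: val_inj; rewrite [RHS]vg_addE /= nvalM. Qed.

Lemma vg_lerD2l (z x y : value_group) : (z + x <= z + y) = (x <= y).
Proof.
suff le (u w t : value_group) : u <= w -> t + u <= t + w.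
  apply/idP/idP => [/(le _ _ (- z))|]; last exact: le.
  by rewrite !addKr.
rewrite !leEsub !vg_addE.
have [a _ ->] := vg_reprP u; have [b _ ->] := vg_reprP w.
have [c _ ->] := vg_reprP t; rewrite -!nvalM => /nval_le[n ab].
by apply/nval_le; exists n; rewrite !normrM -mulrnAr ler_wpM2l.
Qed.

(* nval 1 is the neutral element of the value group, i.e. va >= 0 reads
   nval 1 <= nval a. *)
Definition valring_pred : {pred K} := fun a => nval 1 <= nval a.

Let valringP a : reflect (exists n : nat, `|a| <= n%:R) (a \in valring_pred).
Proof.
change (a \in valring_pred) with (nval 1 <= nval a).
by apply: (iffP idP) => [/nval_le|h]; [|apply/nval_le]; rewrite normr1.
Qed.

Let valring_closed : subring_closed valring_pred.
Proof.
split; first by apply/valringP; exists 1%N; rewrite normr1.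
  move=> a b /valringP[n an] /valringP[m bm]; apply/valringP; exists (n + m)%N.
  by rewrite natrD (le_trans (ler_normB _ _))// lerD.
move=> a b /valringP[n an] /valringP[m bm]; apply/valringP; exists (n * m)%N.
by rewrite natrM normrM ler_pM.
Qed.

HB.instance Definition _ :=
  GRing.isSubringClosed.Build K valring_pred valring_closed.

Record valring := Valring { valring_val :> K; _ : valring_val \in valring_pred }.

HB.instance Definition _ := [isSub for valring_val].
HB.instance Definition _ := [Choice of valring by <:].
HB.instance Definition _ := [SubChoice_isSubComNzRing of valring by <:].

Definition maxideal : {pred valring} := fun a : valring => nval 1 < nval (val a).

Let maxidealP (a : valring) :
  reflect (forall n : nat, `|val a| *+ n < 1) (a \in maxideal).
Proof.
change (a \in maxideal) with (nval 1 < nval (val a)).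
by apply: (iffP idP) => [/nval_lt|h]; [|apply/nval_lt]; rewrite normr1.
Qed.

Let maxideal_closed : idealr_closed maxideal.
Proof.
split.
- by apply/maxidealP => n; rewrite raddf0 normr0 mul0rn.
- by apply/negP => /maxidealP/(_ 1%N); rewrite rmorph1 normr1 mulr1n ltxx.
move=> a x y /maxidealP xM /maxidealP yM; apply/maxidealP => n.
have /valringP[m am] := valP a.
have -> : val (a * x + y) = val a * val x + val y by rewrite rmorphD rmorphM.
have := xM (m * n.*2)%N; have := yM n.*2; rewrite -!mul2n => yn xn.
have : (`|val a * val x + val y| *+ n) *+ 2 < 2%:R.
  apply: (@le_lt_trans _ _ (`|val x| *+ (m * (2 * n)) + `|val y| *+ (2 * n))).
    rewrite -mulrnA [(n * 2)%N]mulnC [`|val x| *+ _]mulrnA -mulrnDl.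
    rewrite lerMn2r (le_trans (ler_normD _ _))// ?orbT // lerD2r normrM.
    by rewrite -[leRHS]mulr_natl ler_wpM2r ?orbT.
  by rewrite [2%:R]mulr2n ltrD.
by rewrite ltrMn2r.
Qed.

HB.instance Definition _ := isIdealr.Build valring maxideal maxideal_closed.

Definition residue_field := {ideal_quot maxideal}.
HB.instance Definition _ := GRing.ComNzRing.on residue_field.

Definition res (a : valring) : residue_field := \pi_{ideal_quot maxideal} a.

HB.instance Definition _ := GRing.RMorphism.copy res (\pi_{ideal_quot maxideal}).

Let res_surj (x : residue_field) : exists a : valring, res a = x.
Proof. by exists (repr x); exact: reprK. Qed.

Let res_eqP (a b : valring) : res a = res b <-> a - b \in maxideal.
Proof.
rewrite Quotient.idealrBE; split=> [h|/eqP h]; last exact: h.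
by apply/eqP; exact: h.
Qed.

Let res_eq0 (a : valring) : (res a == 0) = (a \in maxideal).
Proof.
rewrite -[0](rmorph0 res) -[a in RHS]subr0.
by apply/eqP/idP => /res_eqP.
Qed.

(* insubd 0 only makes the inverse total: (repr x)^-1 is in the valuation ring
   as soon as x != 0. *)
Definition res_inv (x : residue_field) : residue_field :=
  if x == 0 then 0 else res (insubd 0 (val (repr x))^-1).

Let res_mulVf x : x != 0 -> res_inv x * x = 1.
Proof.
move=> x0; rewrite /res_inv (negbTE x0).
have resr : res (repr x) = x by exact: reprK.
rewrite -[X in _ * X]resr -rmorphM -[RHS](rmorph1 res); congr res.
have : repr x \notin maxideal by rewrite -res_eq0 resr.
set a := repr x => aM.
have a0 : val a != 0.
  apply: contraNneq aM => a0; apply/maxidealP => n.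
  by rewrite a0 normr0 mul0rn.
apply: val_inj; rewrite rmorphM rmorph1 /= insubdK ?mulVf//.
apply/valringP; apply: contrapT => /forallNP h; move/negP: aM; apply.
apply/maxidealP => n; have /negP := h n.
rewrite -ltNge normfV => hn.
by rewrite -mulr_natl -ltr_pdivlMr ?normr_gt0// div1r.
Qed.

Let res_inv0 : res_inv 0 = 0. Proof. by rewrite /res_inv eqxx. Qed.

HB.instance Definition _ :=
  GRing.ComNzRing_isField.Build residue_field res_mulVf res_inv0.

(* The order induced by K: one class is below another as soon as some
   representatives are. *)
Definition res_le (x y : residue_field) : bool :=
  `[< exists a b : valring, [/\ res a = x, res b = y & val a <= val b] >].

Definition res_lt (x y : residue_field) : bool := (y != x) && res_le x y.

Definition res_norm (x : residue_field) : residue_field :=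
  if res_le 0 x then x else - x.

Let maxideal_convex (a b : valring) :
  `|val a| <= `|val b| -> b \in maxideal -> a \in maxideal.
Proof.
move=> ab /maxidealP bM; apply/maxidealP => n.
by apply: le_lt_trans (bM n); rewrite lerMn2r ab orbT.
Qed.

Let res_leE (a b : valring) :
  res_le (res a) (res b) = (val a <= val b) || (res a == res b).
Proof.
apply/asboolP/orP => [[a' [b' [aa bb ab]]]|[ab|/eqP ab]]; last 2 first.
- by exists a, b.
- by exists b, b; split.
have [|ba] := leP (val a) (val b); [by left|right].
apply/eqP/res_eqP; apply: (@maxideal_convex _ ((a - a') + (b' - b))).
  rewrite !rmorphD !rmorphN /= ger0_norm ?subr_ge0 ?(ltW ba)//.
  apply: le_trans (ler_norm _).
  by rewrite [X in _ <= _ + X]addrC addrACA lerDl addrC subr_ge0.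
by apply: rpredD; apply/res_eqP.
Qed.

Let res_ge0P (x : residue_field) :
  res_le 0 x -> exists2 a : valring, 0 <= val a & res a = x.
Proof.
have [a <-] := res_surj x; rewrite -(rmorph0 res) res_leE rmorph0.
move=> /orP[a0|/eqP a0]; first by exists a.
by exists 0; [rewrite rmorph0|exact: a0].
Qed.

Let res_ge0 (a : valring) : 0 <= val a -> res_le 0 (res a).
Proof. by move=> a0; rewrite -(rmorph0 res) res_leE rmorph0 a0. Qed.

Let res_le0_add x y : res_le 0 x -> res_le 0 y -> res_le 0 (x + y).
Proof.
move=> /res_ge0P[a a0 <-] /res_ge0P[b b0 <-].
by rewrite -rmorphD res_ge0 // rmorphD addr_ge0.
Qed.

Let res_le0_mul x y : res_le 0 x -> res_le 0 y -> res_le 0 (x * y).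
Proof.
move=> /res_ge0P[a a0 <-] /res_ge0P[b b0 <-].
by rewrite -rmorphM res_ge0 // rmorphM mulr_ge0.
Qed.

Let res_le0_anti x : res_le 0 x -> res_le x 0 -> x = 0.
Proof.
move=> /res_ge0P[a a0 <-]; rewrite -[0](rmorph0 res) res_leE => /orP[a0'|/eqP//].
by congr res; apply/val_inj/le_anti; rewrite a0' rmorph0.
Qed.

Let res_sub_ge0 x y : res_le 0 (y - x) = res_le x y.
Proof.
have [a <-] := res_surj x; have [b <-] := res_surj y.
rewrite -rmorphB -[in LHS](rmorph0 res) !res_leE rmorphB rmorph0 subr_ge0.
by rewrite rmorphB rmorph0 eq_sym subr_eq0 eq_sym.
Qed.

Let res_le0_total x : res_le 0 x || res_le x 0.
Proof.
have [a <-] := res_surj x; have [a0|/ltW a0] := leP 0 (val a).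
  by rewrite res_ge0.
by rewrite -(rmorph0 res) (res_leE a 0) rmorph0 a0 orbT.
Qed.

Let res_normN x : res_norm (- x) = res_norm x.
Proof.
rewrite /res_norm opprK -[- x]sub0r res_sub_ge0 sub0r.
have := res_le0_total x; case: ifP => // x0; case: ifP => // x0' _.
by rewrite (res_le0_anti x0' x0) oppr0.
Qed.

Let res_ge0_norm x : res_le 0 x -> res_norm x = x.
Proof. by rewrite /res_norm => ->. Qed.

HB.instance Definition _ := Num.IntegralDomain_isLeReal.Build residue_field
  res_le0_add res_le0_mul res_le0_anti res_sub_ge0 res_le0_total
  res_normN res_ge0_norm (fun _ _ => erefl : res_lt _ _ = _).

Definition uball a b : set K := [set g | nval (a - b) <= nval (a - g)].

Definition spherically_complete : Prop :=
  forall C : set (set K), C !=set0 ->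
    (forall B, C B -> exists a b, B = uball a b) ->
    total_on C subset ->
    \bigcap_(B in C) B !=set0.

End NaturalValuation.

(* The order preserving embedding of the archimedean ordered field Kv in R is
   unique, so that the existential picks the one used for identifying Kv with a
   subfield of R. *)
Definition has_residue_field_reals (R : realType) (K : realFieldType) : Prop :=
  exists f : {rmorphism residue_field K -> R},
    {mono f : x y / x <= y} /\ range f = [set: R].

(* Main.v *)
(* Write S = {g in vK | some x of value g lies in E} for a cut (D, E) of K with
   0 in D such that E contains, with x, all positive y with v y <= v x. When the
   cofinality of S (resp. coinitiality of its complement T) is uncountable it
   equals the coinitiality of E (resp. cofinality of D), and otherwise the latter
   is countable, and infinite, since x |-> x / 2 (resp. x |-> 2 x) preserves E
   (resp. D). This compares cuts of vK with the cuts of K of this form.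
   Every cut (D, E) of K takes this form after x |-> a + x or x |-> a - x: if
   the values v (e - d) have no maximum, a is a common point of the balls
   through d and e; if they have one, attained at (d0, e0), the residues of
   (d - d0) / (e0 - d0) have a supremum in R, which is the residue of
   (a - d0) / (e0 - d0).
   Conversely, a chain of balls with empty intersection defines a cut whose two
   sides have the cofinality of the chain, and a real missing from the residue
   field is approximated from both sides by countably many rationals. *)

From HB Require Import structures.
Require Import Defs.
From mathcomp Require Import all_boot all_order all_algebra reals.
From mathcomp Require Import generic_quotient ring_quotient.
From mathcomp Require Import boolp classical_sets functions cardinality.

Set Implicit Arguments.
Unset Strict Implicit.
Unset Printing Implicit Defensive.
Import Order.TTheory GRing.Theory Num.Theory.

Local Open Scope classical_set_scope.
Local Open Scope card_scope.
Local Open Scope quotient_scope.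
Local Open Scope ring_scope.

(** * Comparison of cofinalities along maps *)

Lemma cf_card_le (T : Type) (r : rel T) (D A : set T) : reflexive r ->
  cofinal_in r D A -> cf r D #<= A.
Proof. by move=> rr; exact: (cfP D rr).2. Qed.

(** The image under [f] of a least cofinal subset of [D] is cofinal in [D']. The hypotheses ask only
    that [f] eventually dominate each element of [D'], so order-reversing and non-monotone maps are
    covered as well. *)
Lemma card_cf_le (T T' : Type) (r : rel T) (r' : rel T') (f : T -> T')
    (D : set T) (D' : set T') : reflexive r -> reflexive r' ->
    (forall x, D x -> D' (f x)) ->
    (forall y, D' y -> exists2 x0, D x0 &
       forall x, D x -> r x0 x -> r' y (f x)) ->
  cf r' D' #<= cf r D.
Proof.
move=> rr rr' fD fcof; have [[AD Acof] _] := cfP D rr.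
apply: card_le_trans (card_image_le f _); apply: cf_card_le => //.
split=> [_ [x Ax <-]|y Dy]; first exact/fD/AD.
have [x0 Dx0 x0P] := fcof _ Dy; have [a Aa x0a] := Acof _ Dx0.
by exists (f a); [exists a|apply: x0P => //; exact: AD].
Qed.

Lemma countable_cf (T : Type) (r : rel T) (D A : set T) : reflexive r ->
  cofinal_in r D A -> countable A -> countable (cf r D).
Proof. by move=> rr /(cf_card_le rr); exact: sub_countable. Qed.

Lemma cf_countable_max (T : Type) (r : rel T) (D : set T) m : reflexive r ->
  D m -> (forall x, D x -> r x m) -> countable (cf r D).
Proof.
move=> rr Dm mP; apply: (@countable_cf _ _ _ [set m]) => //.
by split=> [_ ->//|x Dx]; exists m => //; exact: mP.
Qed.

(** By induction on its length, a finite list in [D] has an element of [D] strictly beyond all its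
    entries, so it is not cofinal. *)
Lemma infinite_cf (T : Type) (r : rel T) (D : set T) :
    reflexive r -> total r -> transitive r -> D !=set0 ->
    (forall x, D x -> exists2 y, D y & ~~ r y x) ->
  infinite_set (cf r D).
Proof.
(* [Pchoice] equips [T] with a choice structure, so that finite sets can be written as sequences
   with boolean membership. *)
move=> rr rt rtr [d0 Dd0] nomax; elim/Pchoice: T => T in r D rr rt rtr d0 Dd0 nomax *.
have [[AD Acof] _] := cfP D rr.
move=> /finite_seqP[s sE].
have [d Dd ds] : exists2 d, D d & forall x, x \in s -> ~~ r d x.
  have : forall x, x \in s -> D x by move=> x xs; apply: AD; rewrite sE.
  elim: s {sE} => [|x s ih] sD; first by exists d0.
  have [|d Dd ds] := ih; first by move=> y ys; apply: sD; rewrite inE ys orbT.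
  have [dx|dx] := boolP (r d x); last first.
    by exists d => // y; rewrite inE => /predU1P[->|/ds].
  have [y Dy yx] := nomax x (sD x (mem_head _ _)).
  exists y => // z; rewrite inE => /predU1P[->//|/ds dz].
  apply: contra yx => yz; apply: (rtr _ _ _ yz); apply: (rtr d) => //.
  by have := rt d z; rewrite (negbTE dz).
have [a] := Acof _ Dd; rewrite sE => /ds dna da.
by rewrite da in dna.
Qed.

Lemma countable_infinite_card_eq (T T' : Type) (A : set T) (B : set T') :
    countable A -> infinite_set A -> countable B -> infinite_set B ->
  A #= B.
Proof.
move=> cA /infiniteP iA cB /infiniteP iB.
by apply: (@card_eq_trans _ nat _ _ [set: nat]); rewrite card_eq_le; apply/andP.
Qed.

(** * Cofinality and coinitiality in linear orders *)

Section OrderCofinality.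
Context {d : Order.disp_t} {T : orderType d}.
Implicit Types D E : set T.

Lemma ger_refl : reflexive (>=%O : rel T). Proof. by move=> x /=. Qed.

Lemma infinite_cofinality D : D !=set0 ->
  (forall x, D x -> exists2 y, D y & (x < y)%O) -> infinite_set (cofinality D).
Proof.
move=> D0 nomax; apply: infinite_cf => //.
- exact: le_trans.
- by move=> x /nomax[y Dy xy]; exists y => //; rewrite -ltNge.
Qed.

Lemma infinite_coinitiality E : E !=set0 ->
  (forall x, E x -> exists2 y, E y & (y < x)%O) -> infinite_set (coinitiality E).
Proof.
move=> E0 nomin; apply: infinite_cf => //.
- exact: ger_refl.
- by move=> y x z yx zy; exact: le_trans zy yx.
- by move=> x /nomin[y Ey xy]; exists y => //; rewrite -ltNge.
Qed.

Lemma countable_cofinality D A : A `<=` D ->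
  (forall x, D x -> exists2 a, A a & (x <= a)%O) -> countable A ->
  countable (cofinality D).
Proof. by move=> AD Ac; apply: countable_cf. Qed.

Lemma countable_coinitiality E A : A `<=` E ->
  (forall x, E x -> exists2 a, A a & (a <= x)%O) -> countable A ->
  countable (coinitiality E).
Proof. by move=> AE Ac; apply: countable_cf => //; exact: ger_refl. Qed.

Lemma cofinalityP D : cofinality D `<=` D /\
  forall x, D x -> exists2 a, cofinality D a & (x <= a)%O.
Proof. exact: (cfP D (@lexx _ T)).1. Qed.

Lemma coinitialityP E : coinitiality E `<=` E /\
  forall x, E x -> exists2 a, coinitiality E a & (a <= x)%O.
Proof. exact: (cfP E ger_refl).1. Qed.

Lemma uncountable_cofinality_nomax D : ~ countable (cofinality D) ->
  forall x, D x -> exists2 y, D y & (x < y)%O.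
Proof.
move=> cD x Dx; apply: contrapT => h; apply: cD; apply: (cf_countable_max _ Dx) => //.
by move=> y Dy; rewrite leNgt; apply/negP => xy; apply: h; exists y.
Qed.

Lemma uncountable_coinitiality_nomin E : ~ countable (coinitiality E) ->
  forall x, E x -> exists2 y, E y & (y < x)%O.
Proof.
move=> cE x Ex; apply: contrapT => h; apply: cE.
apply: (cf_countable_max ger_refl Ex) => y Ey /=.
by rewrite leNgt; apply/negP => xy; apply: h; exists y.
Qed.

Lemma countable_asymmetric_cut D E :
  asymmetric_cut D E -> ~ (countable (cofinality D) /\ infinite_set (cofinality D) /\
   countable (coinitiality E) /\ infinite_set (coinitiality E)).
Proof.
by move=> /negP h [cD [iD [cE iE]]]; apply: h; exact: countable_infinite_card_eq.
Qed.

End OrderCofinality.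

(** * The natural valuation and positive representatives of its values *)

Section NaturalValuationTheory.
Variable K : realFieldType.
Implicit Types (a b c x y z : K) (g h : value_group K).

Lemma nval_norm x : nval `|x| = nval x.
Proof. by apply/nval_eq; exists 1%N; rewrite normr_id !mulr1n. Qed.

Lemma nvalN x : nval (- x) = nval x.
Proof. by rewrite -nval_norm normrN nval_norm. Qed.

Lemma nvalB x y : nval (x - y) = nval (y - x).
Proof. by rewrite -nvalN opprB. Qed.

Lemma le_nval x y : `|y| <= `|x| -> nval x <= nval y.
Proof. by move=> yx; apply/nval_le; exists 1%N. Qed.

Lemma le0_nval x y : 0 <= y -> y <= x -> nval x <= nval y.
Proof. by move=> y0 yx; apply: le_nval; rewrite !ger0_norm// (le_trans y0). Qed.

Lemma nval_lt_norm x y : nval x < nval y -> `|y| < `|x|.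
Proof. by move=> /nval_lt/(_ 1%N). Qed.

Lemma nval_lt_gt0 x y : 0 < x -> nval x < nval y -> y < x.
Proof.
by move=> x0 /nval_lt_norm; rewrite (gtr0_norm x0); apply/le_lt_trans/ler_norm.
Qed.

(** The ultrametric inequality: if [b] is the larger summand in absolute value, then [a + b] is
    bounded by twice [b]. *)
Lemma nvalD (v : arch_class K) x y :
  v <= nval x -> v <= nval y -> v <= nval (x + y).
Proof.
have key a b : `|a| <= `|b| -> nval b <= nval (a + b).
  move=> ab; apply/nval_le; exists 2%N.
  by rewrite (le_trans (ler_normD _ _))// mulr2n lerD2r.
by have [xy vx vy|/ltW yx vx vy] := leP `|x| `|y|; [|rewrite addrC];
  apply: le_trans (key _ _ _).
Qed.

Definition vg_rep g : K := `|repr (val g)|.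

(** The default class 0 of [insubd] is taken only at [x = 0], whose value lies outside the value
    group. *)
Definition vg_class x : value_group K := insubd (0 : value_group K) (nval x).

Lemma nval_rep g : nval (vg_rep g) = val g.
Proof. by rewrite nval_norm; exact: reprK. Qed.

Lemma vg_rep_gt0 g : 0 < vg_rep g.
Proof.
rewrite lt0r normr_ge0 andbT -nval_eq0 nval_rep; exact: vg_valP.
Qed.

Lemma val_class x : x != 0 -> val (vg_class x) = nval x.
Proof. by move=> x0; rewrite insubdK// -topredE/= nval_eq0. Qed.

Lemma val_class_gt0 x : 0 < x -> val (vg_class x) = nval x.
Proof. by move=> /lt0r_neq0/val_class. Qed.

Lemma vg_repK g : vg_class (vg_rep g) = g.
Proof. by apply: val_inj; rewrite val_class_gt0 ?vg_rep_gt0// nval_rep. Qed.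

Lemma vg_class_le x y : x != 0 -> y != 0 ->
  (vg_class x <= vg_class y) = (nval x <= nval y).
Proof. by move=> x0 y0; rewrite leEsub !val_class. Qed.

Lemma vg_class_lt x y : x != 0 -> y != 0 ->
  (vg_class x < vg_class y) = (nval x < nval y).
Proof. by move=> x0 y0; rewrite ltEsub !val_class. Qed.

Lemma nval_vg_rep x : 0 < x -> nval (vg_rep (vg_class x)) = nval x.
Proof. by move=> x0; rewrite nval_rep val_class_gt0. Qed.

(** Together with the next lemma, this lets the countably many multiples and integer fractions of
    one representative exhaust its archimedean class upwards and downwards. *)
Lemma vg_rep_bound g x : 0 < x -> g <= vg_class x ->
  exists n : nat, x <= vg_rep g *+ n.
Proof.
move=> x0; rewrite leEsub val_class_gt0// -nval_rep => /nval_le[n].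
by rewrite gtr0_norm// gtr0_norm ?vg_rep_gt0//; exists n.
Qed.

Lemma vg_rep_bound_inv g x : 0 < x -> vg_class x <= g ->
  exists n : nat, vg_rep g / n.+1%:R <= x.
Proof.
move=> x0; rewrite leEsub val_class_gt0// -nval_rep => /nval_le[n].
rewrite gtr0_norm ?vg_rep_gt0// gtr0_norm// => gn; exists n.
rewrite ler_pdivrMr ?ltr0Sn// mulr_natr (le_trans gn)//.
by rewrite ler_wpMn2l// ltW.
Qed.

End NaturalValuationTheory.

(** * Elementary properties of cuts *)

Section CutTheory.
Context {d : Order.disp_t} {T : orderType d}.
Variables D E : set T.
Hypothesis cDE : cut D E.

Lemma cutVx x : D x \/ E x.
Proof.
have : (D `|` E) x by have [_ _ -> _] := cDE.
by [].
Qed.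

Lemma cut_lt x y : D x -> E y -> (x < y)%O.
Proof. by case: cDE => _ _ _; apply. Qed.

Lemma cut_up x y : E x -> (x <= y)%O -> E y.
Proof.
move=> Ex xy; have [Dy|//] := cutVx y.
by have := cut_lt Dy Ex; rewrite ltNge xy.
Qed.

Lemma cut_down x y : D y -> (x <= y)%O -> D x.
Proof.
move=> Dy xy; have [//|Ex] := cutVx x.
by have := cut_lt Dy Ex; rewrite ltNge xy.
Qed.

Lemma cut_disj x : D x -> E x -> False.
Proof. by move=> Dx /(cut_lt Dx); rewrite ltxx. Qed.

End CutTheory.

(** * Cuts of the field determined by cuts of the value group *)

Section ValuedCut.
Variable K : realFieldType.

(* These are the cuts of the form D = {x | x <= 0 or v x in T},
   E = {x | 0 < x and v x in S} where S < T and S `|` T = vK. *)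
Definition valued_cut (D E : set K) : Prop :=
  [/\ cut D E, D 0 &
      forall x y, E x -> 0 < y -> nval y <= nval x -> E y].

Variables D E : set K.
Hypothesis vDE : valued_cut D E.

(** [S] comes from the upper side [E] but is the lower side in the value group, since larger
    elements have smaller values. Thus the cofinality of [S] is compared with the coinitiality of
    [E], and the coinitiality of [T] with the cofinality of [D]. *)
Let S : set (value_group K) := [set g | E (vg_rep g)].
Let T : set (value_group K) := [set g | D (vg_rep g)].

Let cDE : cut D E. Proof. by case: vDE. Qed.
Let D0 : D 0. Proof. by case: vDE. Qed.

Let E_gt0 x : E x -> 0 < x. Proof. exact: cut_lt cDE _ _ D0. Qed.

Let E_rep x : E x -> S (vg_class x).
Proof.
move=> Ex; case: vDE => _ _ /(_ x); apply; rewrite ?vg_rep_gt0//.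
by rewrite nval_vg_rep// E_gt0.
Qed.

Let rep_E x g : S g -> 0 < x -> vg_class x <= g -> E x.
Proof.
move=> Sg x0; rewrite leEsub val_class_gt0// => xg; case: vDE => _ _ /(_ _ x Sg).
by apply; rewrite // nval_rep.
Qed.

Let D_rep x : D x -> 0 < x -> T (vg_class x).
Proof.
move=> Dx x0; have [//|Sx] := cutVx cDE (vg_rep (vg_class x)).
by case: (cut_disj cDE Dx); exact: rep_E Sx x0 _.
Qed.

Lemma valued_cut_S0 : S !=set0.
Proof. by have [_ [x /E_rep Sx] _ _] := cDE; exists (vg_class x). Qed.

Lemma valued_cut_ST : S `|` T = [set: value_group K].
Proof.
by apply/seteqP; split=> // g _; have [] := cutVx cDE (vg_rep g); [right|left].
Qed.

Lemma valued_cut_lt g h : S g -> T h -> g < h.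
Proof.
move=> Sg Th; rewrite ltNge; apply/negP => hg; apply: (cut_disj cDE Th).
by apply: (rep_E Sg); rewrite ?vg_rep_gt0// vg_repK.
Qed.

Lemma valued_cutP : T !=set0 -> cut S T.
Proof.
by move=> T0; split=> //; [exact: valued_cut_S0|exact: valued_cut_ST|exact: valued_cut_lt].
Qed.

Lemma infinite_valued_coinitiality : infinite_set (coinitiality E).
Proof.
apply: infinite_coinitiality => [|x Ex]; first by case: cDE.
have x0 := E_gt0 Ex; exists (x / 2%:R); last first.
  by rewrite ltr_pdivrMr ?ltr0n// mulr_natr mulr2n ltrDl.
case: vDE => _ _ /(_ x); apply => //; first by rewrite divr_gt0 ?ltr0n.
apply/nval_le; exists 2%N.
by rewrite normrM normfV normr_nat -[leRHS]mulr_natr divfK// pnatr_eq0.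
Qed.

Lemma infinite_valued_cofinality : T !=set0 -> infinite_set (cofinality D).
Proof.
move=> [t Tt]; apply: infinite_cofinality => [|x Dx]; first by exists 0.
have [x0|x0] := leP x 0.
  by exists (vg_rep t) => //; rewrite (le_lt_trans x0)// vg_rep_gt0.
exists (x *+ 2); last by rewrite mulr2n ltrDl.
have [//|Ex] := cutVx cDE (x *+ 2).
case: (cut_disj cDE Dx); case: vDE => _ _ /(_ _ x Ex); apply => //.
by apply/nval_le; exists 2%N; rewrite normrMn.
Qed.

(** [vg_class] reverses the order on positive elements: whatever lies in [E] below [vg_rep g] has
    class at least [g]. *)
Lemma valued_coinitiality_ge : cofinality S #<= coinitiality E.
Proof.
apply: (card_cf_le (f := @vg_class K)) => //; first exact: ger_refl.
move=> g Sg; exists (vg_rep g) => // x Ex /= xg.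
by rewrite -[g]vg_repK vg_class_le ?gt_eqF ?vg_rep_gt0 ?E_gt0// le0_nval// ltW// E_gt0.
Qed.

Lemma valued_cofinality_ge : T !=set0 -> coinitiality T #<= cofinality D.
Proof.
(* [t] serves as a value for the nonpositive elements of [D], which have no influence on
   cofinality. *)
move=> [t Tt]; apply: (card_cf_le (f := fun x : K => if 0 < x then vg_class x else t)).
- exact: lexx.
- exact: ger_refl.
- by move=> x Dx; case: ifP => // x0; exact: D_rep.
move=> g Tg; exists (vg_rep g) => // x Dx gx /=.
have x0 : 0 < x by rewrite (lt_le_trans (vg_rep_gt0 g)).
rewrite x0 -[X in _ <= X]vg_repK vg_class_le ?gt_eqF ?vg_rep_gt0//.
by rewrite le0_nval// ltW// vg_rep_gt0.
Qed.

Lemma countable_coinitiality_valued :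
  countable (coinitiality E) <-> countable (cofinality S).
Proof.
split=> cS; first exact: sub_countable valued_coinitiality_ge cS.
(* The fractions [vg_rep g / n.+1], for [g] in a countable cofinal subset of [S], are coinitial in
   [E]. *)
have [AS Acof] := cofinalityP S.
apply: (@countable_coinitiality _ _ _
  ((fun p => vg_rep p.1 / p.2.+1%:R) @` (cofinality S `*` [set: nat]))).
- move=> _ [[g n] [/= Ag _] <-]; have gS := AS _ Ag; apply: (rep_E gS).
    by rewrite divr_gt0 ?vg_rep_gt0// ltr0Sn.
  rewrite -[leRHS]vg_repK vg_class_le ?gt_eqF ?divr_gt0 ?vg_rep_gt0 ?ltr0Sn//.
  apply/nval_le; exists n.+1.
  by rewrite normrM normfV normr_nat -[leRHS]mulr_natr divfK// pnatr_eq0.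
- move=> x Ex; have [g Ag xg] := Acof _ (E_rep Ex).
  have [n gnx] := vg_rep_bound_inv (E_gt0 Ex) xg.
  by exists (vg_rep g / n.+1%:R) => //; exists (g, n).
by apply: sub_countable (card_image_le _ _) _; exact: countableX.
Qed.

Lemma countable_cofinality_valued : T !=set0 ->
  countable (cofinality D) <-> countable (coinitiality T).
Proof.
move=> T0; split=> cT; first exact: sub_countable (valued_cofinality_ge T0) cT.
(* The multiples [vg_rep g *+ n], for [g] in a countable coinitial subset of [T], are cofinal in
   [D]. *)
have [AT Acoi] := coinitialityP T.
apply: (@countable_cofinality _ _ _
  ((fun p => vg_rep p.1 *+ p.2) @` (coinitiality T `*` [set: nat]))).
- move=> _ [[g n] [/= Ag _] <-]; have [//|Ex] := cutVx cDE (vg_rep g *+ n).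
  case: (cut_disj cDE (AT _ Ag)); case: vDE => _ _ /(_ _ _ Ex); apply.
    exact: vg_rep_gt0.
  by apply/nval_le; exists n; rewrite normrMn.
- move=> x Dx; have [x0|x0] := leP x 0.
    have [t /Acoi[g Ag _]] := T0; exists (vg_rep g).
      by exists (g, 1%N).
    by rewrite (le_trans x0)// ltW// vg_rep_gt0.
  have [g Ag gx] := Acoi _ (D_rep Dx x0).
  have [n xn] := vg_rep_bound x0 gx.
  by exists (vg_rep g *+ n) => //; exists (g, n).
by apply: sub_countable (card_image_le _ _) _; exact: countableX.
Qed.

(** Uncountable cofinality excludes a maximum of [S], so each [x] in [E] has a class strictly below
    some [g] in [S]. Representatives of all values from [g] on are then below [x], and [vg_rep] maps
    cofinal subsets of [S] to coinitial subsets of [E]. *)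
Lemma uncountable_coinitiality_valued : ~ countable (cofinality S) ->
  coinitiality E #= cofinality S.
Proof.
move=> /uncountable_cofinality_nomax nomax.
rewrite card_eq_le valued_coinitiality_ge andbT.
apply: (card_cf_le (f := @vg_rep K)) => //; first exact: ger_refl.
move=> x Ex; have [g Sg xg] := nomax _ (E_rep Ex); exists g => // h Sh gh /=.
apply/ltW/nval_lt_gt0; first exact: E_gt0.
by rewrite nval_rep -val_class_gt0 ?E_gt0// -ltEsub (lt_le_trans xg).
Qed.

Lemma uncountable_cofinality_valued : ~ countable (coinitiality T) -> T !=set0 ->
  cofinality D #= coinitiality T.
Proof.
move=> /uncountable_coinitiality_nomin nomin T0.
rewrite card_eq_le valued_cofinality_ge// andbT.
apply: (card_cf_le (f := @vg_rep K)) => //; first exact: ger_refl.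
move=> x Dx; have [x0|x0] := leP x 0.
  have [t Tt] := T0; exists t => // h _ _.
  by rewrite (le_trans x0)// ltW// vg_rep_gt0.
have [g Tg gx] := nomin _ (D_rep Dx x0); exists g => // h Th /= hg.
apply/ltW/nval_lt_gt0; first exact: vg_rep_gt0.
by rewrite nval_rep -(val_class_gt0 x0) -ltEsub (le_lt_trans hg).
Qed.

(** If both cofinalities in the value group were countable, those of [D] and [E] would be countably
    infinite, hence equal. If they were equal, both would be uncountable and would therefore
    coincide with those of [E] and [D]. *)
Lemma strongly_asymmetric_value_cut : asymmetric_cut D E -> T !=set0 ->
  strongly_asymmetric_cut S T.
Proof.
move=> aDE T0.
have unc : ~ (countable (cofinality S) /\ countable (coinitiality T)).
  move=> [/countable_coinitiality_valued cE /(countable_cofinality_valued T0) cD].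
  apply: (countable_asymmetric_cut aDE); do !split => //.
    exact: infinite_valued_cofinality.
  exact: infinite_valued_coinitiality.
have {}unc : ~ countable (cofinality S) \/ ~ countable (coinitiality T).
  by apply: contrapT => /not_orP[/contrapT ? /contrapT ?]; apply: unc.
split=> //; apply/negP => ST; move/negP: aDE; apply.
have [cS cT] : ~ countable (cofinality S) /\ ~ countable (coinitiality T).
  by case: unc => unc; split=> //; [rewrite -(eq_countable ST)|rewrite (eq_countable ST)].
apply: card_eq_trans (uncountable_cofinality_valued cT T0) _.
apply: card_eq_trans (card_esym ST) _; apply: card_esym.
exact: uncountable_coinitiality_valued.
Qed.

(** Uncountability transfers from [S] or [T] to [E] or [D]. Equal cofinalities of [D] and [E] would
    then all be uncountable, and would pass back to [S] and [T]. *)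
Lemma strongly_asymmetric_valued_cut :
  strongly_asymmetric_cut S T -> T !=set0 -> strongly_asymmetric_cut D E.
Proof.
move=> [aST unc] T0.
have {}unc : ~ countable (cofinality D) \/ ~ countable (coinitiality E).
  by case: unc => unc; [right=> /countable_coinitiality_valued|
    left=> /(countable_cofinality_valued T0)].
split=> //; apply/negP => DE; move/negP: aST; apply.
have [cD cE] : ~ countable (cofinality D) /\ ~ countable (coinitiality E).
  by case: unc => unc; split=> //; [rewrite -(eq_countable DE)|rewrite (eq_countable DE)].
have cS : ~ countable (cofinality S) by move=> /countable_coinitiality_valued.
have cT : ~ countable (coinitiality T) by move=> /(countable_cofinality_valued T0).
apply: card_eq_trans (card_esym (uncountable_coinitiality_valued cS)) _.
apply: card_eq_trans (card_esym DE) _.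
exact: uncountable_cofinality_valued.
Qed.

Lemma asymmetric_valued_cut :
  strongly_symmetrically_complete (value_group K) -> asymmetric_cut D E.
Proof.
move=> sK; have [T0|T0] := pselect (T !=set0).
  by have [] := strongly_asymmetric_valued_cut (sK _ _ (valued_cutP T0)) T0.
(* With [T] empty, 0 is the maximum of [D], whereas the coinitiality of [E] is infinite. *)
have cD : finite_set (cofinality D).
  apply: (@card_le_finite _ _ _ [set (0 : K)]) => //.
  apply: cf_card_le => //; split=> [_ ->//|x Dx]; exists 0 => //.
  by rewrite leNgt; apply/negP => x0; apply: T0; exists (vg_class x); exact: D_rep.
apply/negP => DE; apply: infinite_valued_coinitiality.
by move: cD; rewrite (eq_finite_set DE).
Qed.

Lemma extremely_asymmetric_valued_cut :
  extremely_symmetrically_complete (value_group K) -> strongly_asymmetric_cut D E.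
Proof.
move=> [sK _ cfK]; have [T0|T0] := pselect (T !=set0).
  exact: strongly_asymmetric_valued_cut (sK _ _ (valued_cutP T0)) T0.
split; first exact: asymmetric_valued_cut.
(* With [T] empty, [S] is the whole value group, whose cofinality is uncountable. *)
right=> /countable_coinitiality_valued.
suff -> : S = setT by [].
rewrite -valued_cut_ST; apply/seteqP; split=> [g|g [//|Tg]]; first by left.
by case: T0; exists g.
Qed.

End ValuedCut.

(** * Embedding an archimedean ordered field in the reals *)

Section ArchimedeanEmbedding.
Variables (R : realType) (F : archiRealFieldType).
Implicit Types (x y : F) (p q : rat) (r : R).

Definition archi_real x : R := sup (@ratr R @` [set q | ratr q <= x]).

Let rat_between (L : archiRealFieldType) (x y : L) :
  x < y -> exists q, (x < ratr q) && (ratr q < y).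
Proof. by move=> /rat_in_itvoo[q]; rewrite in_itv /=; exists q. Qed.

Let has_sup_cut x : has_sup (@ratr R @` [set q | ratr q <= x]).
Proof.
split.
  have [|q /andP[_ /ltW qx]] := @rat_between F (x - 1) x; first by rewrite ltrBlDl ltrDr.
  by exists (ratr q); exists q.
have [|q /andP[xq _]] := @rat_between F x (x + 1); first by rewrite ltrDl.
by exists (ratr q) => _ [p /= px <-]; rewrite ler_rat -(ler_rat F) (le_trans px)// ltW.
Qed.

Lemma archi_real_ge q x : ratr q <= x -> ratr q <= archi_real x.
Proof. by move=> qx; apply: sup_upper_bound => //; exists q. Qed.

Lemma archi_real_le q x : x <= ratr q -> archi_real x <= ratr q.
Proof.
move=> xq; apply: ge_sup; first by case: (has_sup_cut x).
by move=> _ [p /= px <-]; rewrite ler_rat -(ler_rat F) (le_trans px).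
Qed.

(** If [archi_real x] and [r] differed, a rational strictly between them could be compared with [x],
    and either outcome is contradictory. The morphism laws are thereby reduced to rational
    bounds. *)
Lemma archi_real_unique x r :
  (forall q, ratr q < x -> ratr q <= r) ->
  (forall q, x < ratr q -> r <= ratr q) -> archi_real x = r.
Proof.
move=> ler ger; apply/eqP; rewrite eq_le !leNgt; apply/andP; split; apply/negP.
  move=> /rat_between[q /andP[rq qf]].
  have [/archi_real_le|/ler] := leP x (ratr q); first by rewrite leNgt qf.
  by rewrite leNgt rq.
move=> /rat_between[q /andP[fq qr]].
have [/archi_real_ge|/ger] := leP (ratr q) x; first by rewrite leNgt fq.
by rewrite leNgt qr.
Qed.

Let archi_realD x y : archi_real (x + y) = archi_real x + archi_real y.
Proof.
apply: archi_real_unique => q.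
  (* A rational [q] below [x + y] splits as [p + (q - p)] with [p] below [x] and [q - p] below
     [y]. *)
  rewrite -ltrBlDr => /rat_between[p /andP[qyp /ltW px]].
  have : ratr (q - p) <= y by rewrite rmorphB/= lerBlDr -lerBlDl ltW.
  move=> /archi_real_ge; rewrite rmorphB/= => qpy.
  by rewrite -[ratr q](subrK (ratr p)) addrC lerD// archi_real_ge.
rewrite -ltrBrDr => /rat_between[p /andP[/ltW xp pqy]].
have : y <= ratr (q - p) by rewrite rmorphB/= lerBrDr -lerBrDl ltW.
move=> /archi_real_le; rewrite rmorphB/= => yqp.
by rewrite -[ratr q](subrK (ratr p)) addrC lerD// archi_real_le.
Qed.

Let archi_real0 : archi_real 0 = 0.
Proof. by apply: (addrI (archi_real 0)); rewrite -archi_realD !addr0. Qed.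

Let archi_realN x : archi_real (- x) = - archi_real x.
Proof. by apply/eqP; rewrite -addr_eq0 -archi_realD addNr archi_real0. Qed.

Let archi_realB : zmod_morphism archi_real.
Proof. by move=> x y; rewrite archi_realD archi_realN. Qed.

Let archi_real_ge0 x : 0 <= x -> 0 <= archi_real x.
Proof. by move=> x0; rewrite -(rmorph0 (@ratr R)) archi_real_ge// rmorph0. Qed.

Let archi_realM_gt0 x y : 0 < x -> 0 < y ->
  archi_real (x * y) = archi_real x * archi_real y.
Proof.
move=> x0 y0; apply: archi_real_unique => q.
  have [q0 _|q0] := leP q 0.
    by rewrite (@le_trans _ _ 0)// ?lerq0// mulr_ge0// archi_real_ge0// ltW.
  (* The multiplicative splitting: [q] is the product of [p] and [q / p], with [p] below [x] and
     [q / p] below [y]. *)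
  rewrite -ltr_pdivrMr// => /rat_between[p /andP[qyp /ltW px]].
  have p0 : 0 < (ratr p : F) by rewrite (le_lt_trans _ qyp)// divr_ge0 ?ler0q ?ltW.
  have qpy : ratr q / ratr p <= archi_real y.
    rewrite -fmorph_div archi_real_ge// fmorph_div.
    by rewrite ler_pdivrMr// mulrC -ler_pdivrMr// ltW.
  have {}p0 : 0 < (ratr p : R) by move: p0; rewrite !ltr0q.
  rewrite -[ratr q](divfK (lt0r_neq0 p0)) mulrC.
  by rewrite ler_pM ?archi_real_ge ?(ltW p0)// divr_ge0 ?(ltW p0)// ler0q ltW.
rewrite -ltr_pdivlMr// => /rat_between[p /andP[xp pqy]].
have p0 : 0 < (ratr p : F) by rewrite (lt_trans x0).
have yqp : archi_real y <= ratr q / ratr p.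
  rewrite -fmorph_div archi_real_le// fmorph_div.
  by rewrite ler_pdivlMr// mulrC -ler_pdivlMr// ltW.
have {}p0 : 0 < (ratr p : R) by move: p0; rewrite !ltr0q.
rewrite -[ratr q](divfK (lt0r_neq0 p0)) [leRHS]mulrC.
by rewrite ler_pM ?archi_real_le ?archi_real_ge0// ltW.
Qed.

Let archi_realM : monoid_morphism archi_real.
Proof.
split.
  by apply: archi_real_unique => q; rewrite -(rmorph1 (@ratr F)) -(rmorph1 (@ratr R))
    ltr_rat ler_rat => /ltW.
have gtM x y : 0 < x -> archi_real (x * y) = archi_real x * archi_real y.
  move=> x0; have [y0|y0|<-] := ltgtP 0 y; first exact: archi_realM_gt0.
    rewrite -[y]opprK mulrN !archi_realN archi_realM_gt0 ?oppr_gt0//.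
    by rewrite archi_realN !mulrN.
  by rewrite mulr0 archi_real0 mulr0.
move=> x y; have [x0|x0|<-] := ltgtP 0 x; first exact: gtM.
  by rewrite -[x]opprK mulNr !archi_realN gtM ?oppr_gt0// archi_realN !mulNr.
by rewrite mul0r archi_real0 mul0r.
Qed.

HB.instance Definition _ :=
  GRing.isZmodMorphism.Build F R archi_real archi_realB.
HB.instance Definition _ :=
  GRing.isMonoidMorphism.Build F R archi_real archi_realM.

Lemma archi_real_mono : {mono archi_real : x y / x <= y}.
Proof.
apply: le_mono => x y /rat_between[q /andP[xq]] /rat_between[p /andP[qp py]].
apply: le_lt_trans (archi_real_le (ltW xq)) _.
by apply: lt_le_trans (archi_real_ge (ltW py)); rewrite ltr_rat -(ltr_rat F).
Qed.

Lemma archi_real_embedding :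
  exists f : {rmorphism F -> R}, {mono f : x y / x <= y}.
Proof. by exists archi_real; exact: archi_real_mono. Qed.

End ArchimedeanEmbedding.

Lemma archi_embedding (R : realType) (F : realFieldType) :
  Num.archimedean_axiom F ->
  exists f : {rmorphism F -> R}, {mono f : x y / x <= y}.
Proof.
move=> arch.
pose A := Num.NumDomain_bounded_isArchimedean.Build F arch.
pose L : archiRealFieldType := HB.pack F A.
exact: (archi_real_embedding R L).
Qed.

(** * The residue field is archimedean *)

Section ResidueField.
Variable K : realFieldType.
Implicit Types (u w : valring K).

Lemma valringP (x : K) : reflect (exists n : nat, `|x| <= n%:R) (x \in @valring_pred K).
Proof.
apply: (iffP idP) => [/nval_le|h]; [|apply/nval_le]; by rewrite normr1.
Qed.

Lemma res_surj (x : residue_field K) : exists u, res u = x.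
Proof. by exists (repr x); exact: reprK. Qed.

Lemma res_homo u w : val u <= val w -> res u <= res w.
Proof. by move=> uw; apply/asboolP; exists u, w. Qed.

(** Elements of the valuation ring are bounded by a natural number, and so are their residues; the
    successor makes the bound strict. *)
Lemma residue_archimedean : Num.archimedean_axiom (residue_field K).
Proof.
move=> x; have [u <-] := res_surj x.
have /valringP[n un] := valP u; exists n.+1.
rewrite ltr_norml; apply/andP; split.
  rewrite ltrNl -rmorphN; apply: (@le_lt_trans _ _ n%:R); last by rewrite ltr_nat.
  rewrite -(rmorph_nat (@res K)) res_homo// rmorphN rmorph_nat.
  by apply: le_trans un; rewrite -normrN ler_norm.
apply: (@le_lt_trans _ _ n%:R); last by rewrite ltr_nat.
by rewrite -(rmorph_nat (@res K)) res_homo// rmorph_nat; apply: le_trans un; rewrite ler_norm.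
Qed.

Lemma rat_valring (q : rat) : exists w, val w = ratr q.
Proof.
have qV : ratr q \in @valring_pred K.
  apply/valringP; exists (Num.bound `|q|).
  by rewrite -ratr_nat -(ratr_norm K) ler_rat ltW// archi_boundP.
by exists (Valring qV).
Qed.

(** Multiplying by the denominator reduces the claim to integers, which every ring morphism
    preserves. *)
Lemma morph_rat (F : numFieldType) (f : {rmorphism residue_field K -> F}) (q : rat) w :
  val w = ratr q -> f (res w) = ratr q.
Proof.
move=> wq; have dq0 : (denq q)%:~R != 0 :> F by rewrite intr_eq0 denq_eq0.
apply: (mulIf dq0); rewrite /ratr divfK//.
rewrite -(rmorph_int f) -(rmorph_int (@res K)) -!rmorphM -[RHS](rmorph_int f).
rewrite -(rmorph_int (@res K)); congr (f (res _)); apply: val_inj.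
by rewrite rmorphM !rmorph_int/= wq /ratr divfK// intr_eq0 denq_eq0.
Qed.

Lemma has_residue_embedding (R : realType) :
  exists f : {rmorphism residue_field K -> R}, {mono f : x y / x <= y}.
Proof. exact/archi_embedding/residue_archimedean. Qed.

End ResidueField.

(** * Transport of asymmetry between cuts *)

Section CutTransfer.

Lemma cf_preimage (T T' : Type) (r : rel T) (r' : rel T') (f : T -> T') (g : T' -> T)
    (D : set T') : reflexive r -> reflexive r' -> cancel g f -> cancel f g ->
  (forall x y, r x y = r' (f x) (f y)) -> cf r (f @^-1` D) #= cf r' D.
Proof.
move=> rr rr' gK fK rE; rewrite card_eq_le; apply/andP; split.
  apply: (card_cf_le (f := g)) => // [x Dx|y Dy]; first by rewrite /preimage/= gK.
  by exists (f y) => // x Dx yx; rewrite rE gK.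
apply: (card_cf_le (f := f)) => // y Dy.
exists (g y); first by rewrite /preimage/= gK.
by move=> x Dx; rewrite rE gK.
Qed.

Lemma card_eq_asymmetric_cut d d' (T : orderType d) (T' : orderType d')
    (D E : set T) (D' E' : set T') :
    cofinality D' #= cofinality D -> coinitiality E' #= coinitiality E ->
  (asymmetric_cut D' E' -> asymmetric_cut D E) /\
  (strongly_asymmetric_cut D' E' -> strongly_asymmetric_cut D E).
Proof.
move=> DD EE.
have asym : asymmetric_cut D' E' -> asymmetric_cut D E.
  move=> /negP h; apply/negP => DE; apply: h.
  exact: card_eq_trans (card_eq_trans DD DE) (card_esym EE).
split=> // -[/asym aDE cDE]; split=> //.
by rewrite -(eq_countable DD) -(eq_countable EE).
Qed.

(** The variant for order-reversing bijections, which exchange the two sides of a cut. *)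
Lemma card_eq_asymmetric_cutC d d' (T : orderType d) (T' : orderType d')
    (D E : set T) (D' E' : set T') :
    cofinality D' #= coinitiality E -> coinitiality E' #= cofinality D ->
  (asymmetric_cut D' E' -> asymmetric_cut D E) /\
  (strongly_asymmetric_cut D' E' -> strongly_asymmetric_cut D E).
Proof.
move=> DE ED.
have asym : asymmetric_cut D' E' -> asymmetric_cut D E.
  move=> /negP h; apply/negP => DE'; apply: h.
  exact: card_eq_trans DE (card_esym (card_eq_trans ED DE')).
split=> // -[/asym aDE cDE]; split=> //.
by rewrite -(eq_countable DE) -(eq_countable ED); case: cDE; [right|left].
Qed.

End CutTransfer.

(** * Reduction of arbitrary cuts to valued cuts *)

Section NormalForm.
Variable K : realFieldType.
Implicit Types (D E : set K) (a x y : K).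

Definition shift a D : set K := [set x | D (a + x)].
Definition reflect_at a D : set K := [set x | D (a - x)].

Lemma cut_shift D E a : cut D E -> cut (shift a D) (shift a E).
Proof.
move=> cDE; have [[d Dd] [e Ee] _ _] := cDE; split.
- by exists (d - a); rewrite /shift/= addrC subrK.
- by exists (e - a); rewrite /shift/= addrC subrK.
- by apply/seteqP; split=> // x _; exact: cutVx cDE _.
- by move=> x y Dx /(cut_lt cDE Dx); rewrite ltrD2l.
Qed.

Lemma cut_reflect D E a : cut D E -> cut (reflect_at a E) (reflect_at a D).
Proof.
move=> cDE; have [[d Dd] [e Ee] _ _] := cDE; split.
- by exists (a - e); rewrite /reflect_at/= subKr.
- by exists (a - d); rewrite /reflect_at/= subKr.
- by apply/seteqP; split=> // x _; rewrite setUC; exact: cutVx cDE _.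
- by move=> x y Ex /(cut_lt cDE)/(_ Ex); rewrite ltrD2l ltrN2.
Qed.

Lemma asymmetric_cut_shift D E a :
  (asymmetric_cut (shift a D) (shift a E) -> asymmetric_cut D E) /\
  (strongly_asymmetric_cut (shift a D) (shift a E) -> strongly_asymmetric_cut D E).
Proof.
apply: card_eq_asymmetric_cut; apply: (cf_preimage (g := fun x => x - a)).
all: try by move=> x /=; rewrite ?lexx// addrC ?addKr ?subrK.
all: by move=> x y /=; rewrite lerD2l.
Qed.

Lemma asymmetric_cut_reflect D E a :
  (asymmetric_cut (reflect_at a E) (reflect_at a D) -> asymmetric_cut D E) /\
  (strongly_asymmetric_cut (reflect_at a E) (reflect_at a D) ->
     strongly_asymmetric_cut D E).
Proof.
apply: card_eq_asymmetric_cutC; apply: (cf_preimage (g := fun x => a - x)).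
all: try by move=> x /=; rewrite ?lexx ?subKr.
all: by move=> x y /=; rewrite lerD2l lerN2.
Qed.

Definition valued_up_to_affine D E : Prop := exists a,
  valued_cut (shift a D) (shift a E) \/
  valued_cut (reflect_at a E) (reflect_at a D).

(** Negation turns a shift into a reflection and conversely. This reduces the case of a point [a] in
    [E] to that of a point in [D]. *)
Lemma valued_up_to_affineN D E :
  valued_up_to_affine (reflect_at 0 E) (reflect_at 0 D) -> valued_up_to_affine D E.
Proof.
have opp1 a A : shift a (reflect_at 0 A) = reflect_at (- a) A.
  by apply/funext => x; rewrite /shift /reflect_at /= sub0r opprD.
have opp2 a A : reflect_at a (reflect_at 0 A) = shift (- a) A.
  by apply/funext => x; rewrite /shift /reflect_at /= sub0r opprB addrC.
by move=> [a]; rewrite !opp1 !opp2 => -[]; exists (- a); [right|left].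
Qed.

(** For [a + x] in [E], some [e - d] has value strictly above that of [x], and [e - a] has at least
    the value of [e - d]. Hence [y] exceeds [e - a], and [a + y] lies above [e]. *)
Lemma valued_shift_nomax D E a : cut D E -> D a ->
    (forall d e, D d -> E e -> exists d' e',
       [/\ D d', E e' & nval (e - d) < nval (e' - d')]) ->
    (forall d e, D d -> E e -> nval (e - d) <= nval (e - a)) ->
  valued_cut (shift a D) (shift a E).
Proof.
move=> cDE Da nomax aP; split; [exact: cut_shift|by rewrite /shift/= addr0|].
move=> x y Eax y0 yx; have [d [e [Dd Ee]]] := nomax _ _ Da Eax.
rewrite [a + x]addrC addrK => xed; apply: (cut_up cDE Ee).
rewrite -lerBlDl ltW// nval_lt_gt0// (le_lt_trans yx)// (lt_le_trans xed)//.
exact: aP.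
Qed.

(** Since [s] has the largest value, [y] is bounded below by some [s / n.+1], so [a + y] lies above
    a point already known to be in [E]. *)
Lemma valued_shift_max D E a (s : K) : cut D E -> D a -> 0 < s ->
    (forall d e, D d -> E e -> nval (e - d) <= nval s) ->
    (forall n, E (a + s / n.+1%:R)) ->
  valued_cut (shift a D) (shift a E).
Proof.
move=> cDE Da s0 smax aP; split; [exact: cut_shift|by rewrite /shift/= addr0|].
move=> x y Eax y0 yx; have := smax _ _ Da Eax.
rewrite [a + x]addrC addrK => /(le_trans yx)/nval_le[n].
rewrite !gtr0_norm// => syn; apply: (cut_up cDE (aP n)).
rewrite lerD2l ler_pdivrMr ?ltr0Sn// mulr_natr (le_trans syn)//.
by rewrite ler_wpMn2l// ltW.
Qed.

Lemma valued_up_to_affine_nomax D E : spherically_complete K -> cut D E ->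
    (forall d e, D d -> E e -> exists d' e',
       [/\ D d', E e' & nval (e - d) < nval (e' - d')]) ->
  valued_up_to_affine D E.
Proof.
move=> sK cDE nomax.
have [[d0 Dd0] [e0 Ee0] _ _] := cDE.
pose C : set (set K) := [set B | exists d e, [/\ D d, E e & B = uball d e]].
have sub d e d' e' : D d -> E e -> D d' -> E e' -> nval (e - d) <= nval (e' - d') ->
    uball d' e' `<=` uball d e.
  move=> Dd Ee Dd' Ee' le g; rewrite /uball/= !(nvalB d) !(nvalB d') => gP.
  rewrite -[g](subrK d') -addrA; apply: nvalD; first exact: le_trans gP.
  (* It remains to place [d'] in the ball of [d] and [e]: either [d'] lies between [d] and [e], or
     [d] lies between [d'] and [e']. *)
  have [dd'|/ltW d'd] := leP d d'.
    by rewrite le0_nval ?subr_ge0// lerB// ltW// (cut_lt cDE).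
  rewrite [leRHS]nvalB; apply: (le_trans le).
  by rewrite le0_nval ?subr_ge0// lerB// ltW// (cut_lt cDE).
have [||B B' [d [e [Dd Ee ->]]] [d' [e' [Dd' Ee' ->]]]|a aP] := sK C.
- by exists (uball d0 e0), d0, e0.
- by move=> B [d [e [_ _ ->]]]; exists d, e.
- by have [le|/ltW le] := leP (nval (e - d)) (nval (e' - d')); [right|left]; exact: sub.
have aD d e : D d -> E e -> nval (e - d) <= nval (a - d).
  by move=> Dd Ee; rewrite nvalB [leRHS]nvalB; apply: (aP (uball d e)); exists d, e.
have aE d e : D d -> E e -> nval (e - d) <= nval (e - a).
  move=> Dd Ee; have -> : e - a = (e - d) + (d - a) by rewrite addrA subrK.
  by rewrite nvalD// [leRHS]nvalB aD.
have [Da|Ea] := cutVx cDE a.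
  by exists a; left; exact: valued_shift_nomax.
apply: valued_up_to_affineN; exists (- a); left; apply: valued_shift_nomax.
- exact: cut_reflect.
- by rewrite /reflect_at/= sub0r opprK.
- move=> e d; rewrite /reflect_at/= !sub0r => Ee Dd.
  have [d' [e' [Dd' Ee' lt]]] := nomax _ _ Dd Ee.
  exists (- e'), (- d'); rewrite !sub0r !opprK; split=> //.
  by rewrite [- d' + _]addrC; move: lt; rewrite opprK [- e + _]addrC.
move=> e d; rewrite /reflect_at/= !sub0r => Ee Dd.
by have := aD _ _ Dd Ee; rewrite !opprK [- e + _]addrC [a + d]addrC.
Qed.

Lemma valued_up_to_affine_max (R : realType) D E (d0 e0 : K) :
    has_residue_field_reals R K -> cut D E -> D d0 -> E e0 ->
    (forall d e, D d -> E e -> nval (e - d) <= nval (e0 - d0)) ->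
  valued_up_to_affine D E.
Proof.
move=> [f [fmono fsurj]] cDE Dd0 Ee0 smax; set s := e0 - d0 in smax.
have s0 : 0 < s by rewrite subr_gt0 (cut_lt cDE).
(* [A] consists of the residues of those [(d - d0) / s], with [d] in [D], that lie in the valuation
   ring; it contains 0 and is bounded by 1. *)
pose A : set R := [set f (res w) | w in [set w : valring K | D (d0 + s * val w)]].
have A0 : A (f 0).
  by exists 0; rewrite /= ?rmorph0// mulr0 addr0.
have hA : has_sup A.
  split; first by exists (f 0).
  exists (f 1) => _ [w Dw <-]; rewrite fmono -(rmorph1 (@res K)) res_homo// rmorph1.
  by rewrite -(ler_pM2l s0) -(lerD2l d0) mulr1 [d0 + s]addrC subrK ltW// (cut_lt cDE).
have [x _ fx] : range f (sup A) by rewrite fsurj.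
have [u uE] := res_surj x; rewrite -{}uE in fx.
have inv n : exists w : valring K, val w = n.+1%:R^-1 /\ 0 < f (res w).
  have [w wE] := rat_valring K (n.+1%:R^-1); exists w; split.
    by rewrite wE fmorphV rmorph_nat.
  by rewrite (morph_rat f wE) ltr0q invr_gt0 ltr0Sn.
pose a := d0 + s * val u.
(* If [a + s / n.+1] were in [D], it would contribute to [A] an element larger than [sup A]. *)
have aD : D a -> forall n, E (a + s / n.+1%:R).
  move=> _ n; have [Da|//] := cutVx cDE (a + s / n.+1%:R).
  have [w [wE w0]] := inv n.
  have : A (f (res (u + w))).
    exists (u + w) => //; change (D (d0 + s * val (u + w))).
    by rewrite rmorphD/= wE mulrDr addrA.
  move=> /(sup_upper_bound hA); rewrite -fx !rmorphD/=.
  by rewrite gerDl leNgt w0.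
(* If [a - s / n.+1] were in [E], it would yield an upper bound of [A] smaller than [sup A]. *)
have aE : E a -> forall n, D (a - s / n.+1%:R).
  move=> _ n; have [//|Ea] := cutVx cDE (a - s / n.+1%:R).
  have [w [wE w0]] := inv n.
  suff : sup A <= f (res (u - w)).
    by rewrite -fx !rmorphB/= lerBrDr gerDl leNgt w0.
  apply: ge_sup => [|_ [v Dv <-]]; first by exists (f 0).
  rewrite fmono res_homo// rmorphB /= wE -(ler_pM2l s0) -(lerD2l d0).
  by rewrite mulrBr addrA ltW// (cut_lt cDE).
have [Da|Ea] := cutVx cDE a.
  by exists a; left; apply: (valued_shift_max (s := s)) => //; exact: aD.
apply: valued_up_to_affineN; exists (- a); left.
apply: (valued_shift_max (s := s)) => //.
- exact: cut_reflect.
- by rewrite /reflect_at/= sub0r opprK.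
- move=> e d; rewrite /reflect_at/= !sub0r => Ee Dd.
  by have := smax _ _ Dd Ee; rewrite opprK addrC.
- by move=> n; rewrite /reflect_at/= sub0r opprD opprK; exact: aE.
Qed.

Lemma cut_valued_up_to_affine (R : realType) D E : spherically_complete K ->
  has_residue_field_reals R K -> cut D E -> valued_up_to_affine D E.
Proof.
move=> sK resK cDE.
have [nomax|/existsNP[d0 /existsNP[e0 /not_implyP[Dd0 /not_implyP[Ee0 h]]]]] :=
    pselect (forall d e, D d -> E e -> exists d' e',
       [/\ D d', E e' & nval (e - d) < nval (e' - d')]).
  exact: valued_up_to_affine_nomax.
apply: (valued_up_to_affine_max resK cDE Dd0 Ee0) => d e Dd Ee.
by rewrite leNgt; apply/negP => lt; apply: h; exists d, e.
Qed.

Lemma symmetrically_complete_of_valued (R : realType) : spherically_complete K ->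
    has_residue_field_reals R K ->
    strongly_symmetrically_complete (value_group K) ->
  symmetrically_complete K.
Proof.
move=> sK resK gK D E cDE; have [a] := cut_valued_up_to_affine sK resK cDE.
move=> [/asymmetric_valued_cut|/asymmetric_valued_cut] /(_ gK).
  exact: (asymmetric_cut_shift _ _ _).1.
exact: (asymmetric_cut_reflect _ _ _).1.
Qed.

Lemma strongly_symmetrically_complete_of_valued (R : realType) :
    spherically_complete K -> has_residue_field_reals R K ->
    extremely_symmetrically_complete (value_group K) ->
  strongly_symmetrically_complete K.
Proof.
move=> sK resK gK D E cDE; have [a] := cut_valued_up_to_affine sK resK cDE.
move=> [/extremely_asymmetric_valued_cut|/extremely_asymmetric_valued_cut] /(_ gK).
  exact: (asymmetric_cut_shift _ _ _).2.
exact: (asymmetric_cut_reflect _ _ _).2.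
Qed.

End NormalForm.

(** * Value group and residue field of a symmetrically complete field *)

Section Converse.
Variable K : realFieldType.
Implicit Types (x y : K).

Lemma cut_value_group (S T : set (value_group K)) : cut S T ->
  valued_cut [set x | x <= 0 \/ T (vg_class x)] [set x | 0 < x /\ S (vg_class x)].
Proof.
move=> cST; have [[s Ss] [t Tt] _ _] := cST; split; [split| |].
- by exists 0; left.
- by exists (vg_rep s); split; rewrite ?vg_rep_gt0// vg_repK.
- apply/seteqP; split=> // x _; have [x0|x0] := leP x 0; first by left; left.
  by have [Sx|Tx] := cutVx cST (vg_class x); [right|left; right].
- move=> x y [x0|Tx] [y0 Sy]; first exact: le_lt_trans x0 y0.
  apply: nval_lt_gt0 => //; have := cut_lt cST Sy Tx.
  (* At [x = 0] the class is only a default, but the value of 0 is infinite and the inequality still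
     holds. *)
  have [->|x0] := eqVneq x 0; last by rewrite vg_class_lt// gt_eqF.
  by move=> _; rewrite lt_neqAle nval_le_infty nval_eq0 gt_eqF.
- by left.
move=> x y [x0 Sx] y0 yx; split=> //; apply: (cut_down cST Sx).
by rewrite vg_class_le// gt_eqF.
Qed.

Lemma symmetrically_complete_value_group : symmetrically_complete K ->
  strongly_symmetrically_complete (value_group K).
Proof.
move=> sK S T cST; have := cut_value_group cST.
set D := [set x : K | _ \/ _]; set E := [set x : K | _ /\ _] => vDE.
have := strongly_asymmetric_value_cut vDE.
have -> : [set g | E (vg_rep g)] = S.
  apply/seteqP; split=> g; first by move=> [_]; rewrite vg_repK.
  by move=> Sg; split; rewrite ?vg_rep_gt0// vg_repK.
have -> : [set g | D (vg_rep g)] = T.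
  apply/seteqP; split=> g; last by move=> Tg; right; rewrite vg_repK.
  by move=> [|]; rewrite ?vg_repK// leNgt vg_rep_gt0.
by apply; [apply: sK; case: vDE|case: cST].
Qed.

(** A real [r] outside the image cuts the rationals of [K] into two parts, and these generate a cut
    of [K] with both cofinalities countably infinite. *)
Lemma symmetrically_complete_residue (R : realType) :
  symmetrically_complete K -> has_residue_field_reals R K.
Proof.
move=> sK; have [f fmono] := has_residue_embedding K R.
exists f; split=> //; apply/seteqP; split=> // r _.
apply: contrapT => nr.
have ratN q : ratr q != r.
  apply/eqP => qr; apply: nr; have [w wE] := rat_valring K q.
  by exists (res w) => //; rewrite (morph_rat f wE).
have le_rat (q : rat) (w : valring K) : ratr q < f (res w) -> ratr q < val w.
  move=> qw; rewrite ltNge; apply/negP => wq; have [v vE] := rat_valring K q.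
  have /res_homo : val w <= val v by rewrite vE.
  by rewrite -fmono (morph_rat f vE) leNgt qw.
have rat_le (q : rat) (w : valring K) : f (res w) < ratr q -> val w < ratr q.
  move=> wq; rewrite ltNge; apply/negP => qw; have [v vE] := rat_valring K q.
  have /res_homo : val v <= val w by rewrite vE.
  by rewrite -fmono (morph_rat f vE) leNgt wq.
have above q : ratr q < r -> exists2 p, ratr p < r & q < p.
  by move=> /rat_in_itvoo[p]; rewrite in_itv/= ltr_rat => /andP[qp pr]; exists p.
have below q : r < ratr q -> exists2 p, r < ratr p & p < q.
  by move=> /rat_in_itvoo[p]; rewrite in_itv/= ltr_rat => /andP[rp pq]; exists p.
have [q1 q1r] : exists q, ratr q < r.
  have : r - 1 < r by rewrite ltrBlDl ltrDr.
  by move=> /rat_in_itvoo[q]; rewrite in_itv/= => /andP[_ qr]; exists q.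
have [q2 rq2] : exists q, r < ratr q.
  have : r < r + 1 by rewrite ltrDl.
  by move=> /rat_in_itvoo[q]; rewrite in_itv/= => /andP[rq _]; exists q.
pose D : set K := [set x | exists2 q, ratr q < r & x <= ratr q].
pose E : set K := [set x | exists2 q, r < ratr q & ratr q <= x].
have cDE : cut D E.
  split.
  - by exists (ratr q1), q1.
  - by exists (ratr q2), q2.
  - apply/seteqP; split=> // x _.
    have [[q qr xq]|nD] := pselect (D x); first by left; exists q.
    have [[q rq qx]|nE] := pselect (E x); first by right; exists q.
    (* Lying between [q1] and [q2], [x] has a residue. Its image differs from [r], so a rational
       separates them and puts [x] on one side. *)
    have xV : x \in @valring_pred K.
      have q1x : ratr q1 < x by rewrite ltNge; apply/negP => ?; apply: nD; exists q1.
      have xq2 : x < ratr q2 by rewrite ltNge; apply/negP => ?; apply: nE; exists q2.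
      have /valringP[n1 h1] : (ratr q1 : K) \in @valring_pred K.
        by have [w <-] := rat_valring K q1; exact: valP.
      have /valringP[n2 h2] : (ratr q2 : K) \in @valring_pred K.
        by have [w <-] := rat_valring K q2; exact: valP.
      apply/valringP; exists (n1 + n2)%N; rewrite natrD ler_norml.
      move: h1 h2; rewrite !ler_norml => /andP[h1 _] /andP[_ h2]; apply/andP; split.
        by rewrite (le_trans _ (ltW q1x))// (le_trans _ h1)// lerN2 lerDl.
      by rewrite (le_trans (ltW xq2))// (le_trans h2)// lerDr.
    pose w : valring K := Valring xV.
    have [lt|lt|eqr] := ltgtP (f (res w)) r.
    + have [q] := rat_in_itvoo lt; rewrite in_itv/= => /andP[wq qr].
      by left; exists q => //; exact/ltW/(rat_le _ w).
    + have [q] := rat_in_itvoo lt; rewrite in_itv/= => /andP[rq qw].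
      by right; exists q => //; exact/ltW/(le_rat _ w).
    + by case: nr; exists (res w).
  - move=> x y [q qr xq] [p rp py]; apply: (le_lt_trans xq); apply: lt_le_trans py.
    by rewrite ltr_rat -(ltr_rat R) (lt_trans qr).
apply: (countable_asymmetric_cut (sK _ _ cDE)); do !split.
- apply: (@countable_cofinality _ _ _ (@ratr K @` [set q | ratr q < r])).
  + by move=> _ [q qr <-]; exists q.
  + by move=> x [q qr xq]; exists (ratr q) => //; exists q.
  + exact: sub_countable (card_image_le _ _) _.
- apply: infinite_cofinality; first by exists (ratr q1), q1.
  move=> x [q /above[p pr qp] xq]; exists (ratr p); first by exists p.
  by rewrite (le_lt_trans xq)// ltr_rat.
- apply: (@countable_coinitiality _ _ _ (@ratr K @` [set q | r < ratr q])).
  + by move=> _ [q qr <-]; exists q.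
  + by move=> x [q qr xq]; exists (ratr q) => //; exists q.
  + exact: sub_countable (card_image_le _ _) _.
- apply: infinite_coinitiality; first by exists (ratr q2), q2.
  move=> x [q /below[p pr pq] qx]; exists (ratr p); first by exists p.
  by rewrite (lt_le_trans _ qx)// ltr_rat.
Qed.

(** * Chains of ultrametric balls *)

Lemma uball_refl (a b : K) : uball a b a.
Proof. by rewrite /uball/= subrr nval_le_infty. Qed.

Lemma uball_convex (a b x y z : K) : uball a b x -> uball a b z ->
  x <= y -> y <= z -> uball a b y.
Proof.
rewrite /uball/= !(nvalB a) => ax az xy yz.
rewrite -[y](subrK x) -addrA nvalD//.
apply: (@le_trans _ _ (nval (z - x))); last first.
  by rewrite le0_nval ?subr_ge0// lerB.
have -> : z - x = (z - a) + (a - x) by rewrite addrA subrK.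
by rewrite nvalD// [leRHS]nvalB.
Qed.

Lemma uball_reflect (a b x y : K) : uball a b x -> uball a b y ->
  uball a b (y + y - x).
Proof.
rewrite /uball/= !(nvalB a) => ax ay.
have -> : y + y - x - a = (y - a) + ((y - a) + (a - x)).
  by rewrite [y - a + (a - x)]addrA subrK -!addrA; congr (_ + _);
    rewrite [RHS]addrCA [- a - x]addrC.
by apply: nvalD => //; apply: nvalD => //; rewrite [leRHS]nvalB.
Qed.

Definition below_ball (C : set (set K)) : set K :=
  [set x | exists2 B, C B & forall y, B y -> x < y].

Definition above_ball (C : set (set K)) : set K :=
  [set x | exists2 B, C B & forall y, B y -> y < x].

(* An element x of a ball of the chain falls out of a smaller ball; reflecting
   x in a point of the smaller ball gives an element on its other side. *)
Lemma ball_chain_sides (C : set (set K)) B :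
    (forall B, C B -> exists a b, B = uball a b) -> total_on C subset ->
    \bigcap_(B in C) B = set0 -> C B ->
  exists2 B', C B' & (exists2 x, B x & forall y, B' y -> x < y) /\
                     (exists2 x, B x & forall y, B' y -> y < x).
Proof.
move=> Cball Ctot C0 CB; have [a [b BE]] := Cball _ CB.
have Ba : B a by rewrite BE; exact: uball_refl.
have [B' CB' nB'a] : exists2 B', C B' & ~ B' a.
  apply: contrapT => h; have : (\bigcap_(B in C) B) a; last by rewrite C0.
  by move=> B' CB'; apply: contrapT => nB'a; apply: h; exists B'.
exists B' => //; have [c [d B'E]] := Cball _ CB'.
have B'B : B' `<=` B by have [|/(_ _ Ba)] := Ctot _ _ CB' CB.
have B'c : B' c by rewrite B'E; exact: uball_refl.
have Br : B (c + c - a) by rewrite BE; apply: uball_reflect; rewrite -BE//; exact: B'B.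
(* Reflection in [c] is an involution preserving [B'], so [a] and its mirror image both lie outside
   [B'], on opposite sides. *)
have nB'r : ~ B' (c + c - a).
  move=> B'r; apply: nB'a; rewrite -[a](subKr (c + c)).
  by rewrite B'E; apply: uball_reflect; rewrite -B'E.
have side x y : B' x -> ~ B' y -> y < x -> forall z, B' z -> y < z.
  move=> B'x nB'y yx z B'z; rewrite ltNge; apply/negP => zy; apply: nB'y.
  by rewrite B'E; apply: (@uball_convex c d z y x); rewrite -?B'E// ltW.
have side' x y : B' x -> ~ B' y -> x < y -> forall z, B' z -> z < y.
  move=> B'x nB'y yx z B'z; rewrite ltNge; apply/negP => zy; apply: nB'y.
  by rewrite B'E; apply: (@uball_convex c d x y z); rewrite -?B'E// ltW.
have [ac|ca|ac] := ltgtP a c; last by case: nB'a; rewrite ac.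
  split; first by exists a => //; exact: side B'c nB'a ac.
  by exists (c + c - a) => //; apply: side' B'c nB'r _; rewrite -addrA ltrDl subr_gt0.
split; last by exists a => //; exact: side' B'c nB'a ca.
by exists (c + c - a) => //; apply: side B'c nB'r _; rewrite -addrA gtrDl subr_lt0.
Qed.

Lemma symmetrically_complete_spherically_complete :
  symmetrically_complete K -> spherically_complete K.
Proof.
move=> sK; rewrite /spherically_complete => C [B0 CB0] Cball Ctot.
apply: contrapT => /nonemptyPn C0.
have sides B (CB : C B) := ball_chain_sides Cball Ctot C0 CB.
pose D := below_ball C; pose E := above_ball C.
have inD B : C B -> exists2 x, B x & D x.
  by move=> /sides[B' CB' [[x Bx xB'] _]]; exists x => //; exists B'.
have inE B : C B -> exists2 x, B x & E x.
  by move=> /sides[B' CB' [_ [x Bx xB']]]; exists x => //; exists B'.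
have DE x y : D x -> E y -> x < y.
  move=> [B CB xB] [B' CB' B'y].
  have [BB'|B'B] := Ctot _ _ CB CB'.
    by have [z Bz _] := inD _ CB; rewrite (lt_trans (xB _ Bz))// B'y//; exact: BB'.
  by have [z B'z _] := inD _ CB'; rewrite (lt_trans (xB _ (B'B _ B'z)))// B'y.
have cDE : cut D E.
  split; [by have [x _ Dx] := inD _ CB0; exists x|
          by have [x _ Ex] := inE _ CB0; exists x| |exact: DE].
  apply/seteqP; split=> // x _.
  have [B CB nBx] : exists2 B, C B & ~ B x.
    apply: contrapT => h; have : (\bigcap_(B in C) B) x; last by rewrite C0.
    by move=> B' CB'; apply: contrapT => nB'x; apply: h; exists B'.
  have [a [b BE]] := Cball _ CB.
  have Ba : B a by rewrite BE; exact: uball_refl.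
  have [xa|ax|xa] := ltgtP x a; last by case: nBx; rewrite xa.
    left; exists B => // y By; rewrite ltNge; apply/negP => yx; apply: nBx.
    by rewrite BE; apply: (@uball_convex a b y x a); rewrite -?BE// ltW.
  right; exists B => // y By; rewrite ltNge; apply/negP => yx; apply: nBx.
  by rewrite BE; apply: (@uball_convex a b a x y); rewrite -?BE// ltW.
(* [h] and [k] exchange the two sides: [x] lies off some ball of the chain, and its image is chosen
   inside that ball on the other side. *)
have /choice[h hP] : forall x, exists y, D x ->
    E y /\ exists B, [/\ C B, forall z, B z -> x < z & B y].
  move=> x.
  have [[B CB xB]|nDx] := pselect (D x); last by exists 0.
  by have [y By Ey] := inE _ CB; exists y => _; split=> //; exists B.
have /choice[k kP] : forall x, exists y, E x ->
    D y /\ exists B, [/\ C B, forall z, B z -> z < x & B y].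
  move=> x.
  have [[B CB xB]|nEx] := pselect (E x); last by exists 0.
  by have [y By Dy] := inD _ CB; exists y => _; split=> //; exists B.
move/negP: (sK _ _ cDE); apply; rewrite card_eq_le; apply/andP; split.
  apply: (card_cf_le (f := k)) => //; first exact: ger_refl.
    by move=> x /kP[].
  (* For [x] in [E] below [x0], the ball [B'] witnessing [x] misses [x0], which lies in [B]. Hence
     [B'] is contained in [B], and [k x] is above [y]. *)
  move=> y [B CB yB]; have [x0 Bx0 Ex0] := inE _ CB; exists x0 => // x Ex /= xx0.
  have [_ [B' [CB' B'x B'k]]] := kP _ Ex.
  apply/ltW/yB; have [BB'|] := Ctot _ _ CB CB'; last exact.
  by have := B'x _ (BB' _ Bx0); rewrite ltNge xx0.
apply: (card_cf_le (f := h)) => //; first exact: ger_refl.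
  by move=> x /hP[].
move=> y [B CB By]; have [x0 Bx0 Dx0] := inD _ CB; exists x0 => // x Dx /= x0x.
have [_ [B' [CB' xB' B'h]]] := hP _ Dx.
apply/ltW/By; have [BB'|] := Ctot _ _ CB CB'; last exact.
by have := xB' _ (BB' _ Bx0); rewrite ltNge x0x.
Qed.

(** * Cofinality and coinitiality of the field and of its value group *)

Lemma countable_cofinality_field :
  countable (cofinality [set: K]) <-> countable (coinitiality [set: value_group K]).
Proof.
split=> cK.
  apply: sub_countable cK; apply: (card_cf_le (f := @vg_class K)) => //.
    exact: ger_refl.
  move=> g _; exists (vg_rep g) => // x _ gx /=.
  rewrite -[leRHS]vg_repK vg_class_le ?gt_eqF ?vg_rep_gt0//; last first.
    by rewrite (lt_le_trans (vg_rep_gt0 g)).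
  by rewrite le0_nval// ltW// vg_rep_gt0.
have [_ Acoi] := coinitialityP [set: value_group K].
apply: (@countable_cofinality _ _ _
  ((fun p => vg_rep p.1 *+ p.2) @` (coinitiality [set: value_group K] `*` [set: nat]))) => //.
  (* Passing to [|x| + 1] gives a positive element above [x], which therefore has a class. *)
  move=> x _; have [g Ag gx] := Acoi (vg_class (`|x| + 1)) I.
  have [n xn] := vg_rep_bound (ltr_pwDr ltr01 (normr_ge0 x)) gx.
  exists (vg_rep g *+ n); first by exists (g, n).
  by apply: le_trans xn; rewrite (le_trans (ler_norm x))// lerDl.
by apply: sub_countable (card_image_le _ _) _; exact: countableX.
Qed.

Lemma countable_coinitiality_field :
  countable (coinitiality [set: K]) <-> countable (cofinality [set: K]).
Proof.
suff /eq_countable -> : coinitiality [set: K] #= cofinality [set: K] by [].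
apply: (cf_preimage (f := -%R) (g := -%R)) => //; [exact: ger_refl|exact: opprK..|].
by move=> x y /=; rewrite lerN2.
Qed.

Lemma countable_coinitiality_value_group :
  countable (coinitiality [set: value_group K]) <->
  countable (cofinality [set: value_group K]).
Proof.
have le_opp (g h : value_group K) : (- g <= - h) = (h <= g).
  by rewrite -[LHS](vg_lerD2l (g + h)) addrK [g + h]addrC addrK.
suff /eq_countable -> : coinitiality [set: value_group K] #=
    cofinality [set: value_group K] by [].
apply: (cf_preimage (f := -%R) (g := -%R)) => //; [exact: ger_refl|exact: opprK..].
Qed.

(** In the cut just above 0 the lower side has a maximum, so the coinitiality of the positive
    elements is uncountable. Inversion would turn a countable cofinal subset of [K] into a countable
    coinitial set of positive elements. *)
Lemma strongly_symmetrically_complete_extremely :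
  strongly_symmetrically_complete K -> extremely_symmetrically_complete K.
Proof.
move=> sK; suff cK : ~ countable (cofinality [set: K]).
  by split=> // /countable_coinitiality_field.
move=> cK; pose D : set K := [set x | x <= 0]; pose E : set K := [set x | 0 < x].
have cDE : cut D E.
  split; [by exists 0; rewrite /D/=|by exists 1; rewrite /E/= ltr01| |].
    by apply/seteqP; split=> // x _; have [] := leP x 0; [left|right].
  by move=> x y; exact: le_lt_trans.
have [_ []] := sK _ _ cDE; apply.
  by apply: (cf_countable_max (m := 0)) => //; rewrite /D/=.
have [_ Acof] := cofinalityP [set: K].
apply: (@countable_coinitiality _ _ _
  ((fun x => x^-1) @` [set x | cofinality [set: K] x /\ 0 < x])).
- by move=> _ [x [_ x0] <-]; rewrite /E/= invr_gt0.
- move=> x x0; have [a Aa xa] := Acof x^-1 I.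
  have a0 : 0 < a by rewrite (lt_le_trans _ xa)// invr_gt0.
  exists a^-1; first by exists a.
  by rewrite -[leRHS]invrK lef_pV2 ?posrE ?invr_gt0.
apply: sub_countable (card_image_le _ _) _.
by apply: sub_countable cK; apply: subset_card_le => x [].
Qed.

End Converse.

Theorem theorem5 (R : realType) (K : realFieldType) :
  (symmetrically_complete K <->
     [/\ spherically_complete K,
         has_residue_field_reals R K
       & strongly_symmetrically_complete (value_group K)]) /\
  ((strongly_symmetrically_complete K <-> extremely_symmetrically_complete K) /\
   (extremely_symmetrically_complete K <->
     [/\ spherically_complete K,
         has_residue_field_reals R K
       & extremely_symmetrically_complete (value_group K)])).
Proof.
have symP : symmetrically_complete K -> [/\ spherically_complete K,
    has_residue_field_reals R K & strongly_symmetrically_complete (value_group K)].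
  move=> sK; split.
  - exact: symmetrically_complete_spherically_complete.
  - exact: symmetrically_complete_residue.
  - exact: symmetrically_complete_value_group.
split; first by split=> [|[]]; [exact: symP|exact: symmetrically_complete_of_valued].
split; split.
- exact: strongly_symmetrically_complete_extremely.
- by case.
- move=> [sK _ cK]; have [|? ? gK] := symP; first by move=> D E /sK[].
  have ciG : ~ countable (coinitiality [set: value_group K]).
    by move=> /(countable_cofinality_field K).2/cK.
  have cfG : ~ countable (cofinality [set: value_group K]).
    by move=> /(countable_coinitiality_value_group K).2/ciG.
  split; [assumption|assumption|split; [exact: gK|exact: ciG|exact: cfG]].
(* The valuation-theoretic condition gives strong symmetric completeness, which already makes both
   ends of [K] uncountable. *)
move=> [sK resK gK]; apply: strongly_symmetrically_complete_extremely.
exact: (strongly_symmetrically_complete_of_valued sK resK).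
Qed.
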